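(* For an arbitrary Legendrian knot $K$ in $\mathcal{H}\cup\{\infty\}$ and any Möbius transformation $T\in\mathrm{PU}(2,1)$, $E(K)=E(T(K))$ holds.
   Context: $\mathcal{H}=\mathbb{C}\times\mathbb{R}$ is the 3-dimensional Heisenberg group with coordinates $(z,u)=(x,y,u)$, group law $(z,u)\cdot(z',u')=(z+z',u+u'-\tfrac{1}{2}\Im(z\overline{z'}))$, horizontal distribution spanned by $X=\partial_x-\tfrac12 y\,\partial_u$, $Y=\partial_y+\tfrac12 x\,\partial_u$ (orthonormal, norm $|\cdot|$). The Korányi distance is $d_{\mathcal{H}}(p,q)=\|p^{-1}q\|_{\mathcal{H}}$, $\|(x,y,u)\|_{\mathcal{H}}=\sqrt[4]{(x^2+y^2)^2+16u^2}$, with balls $\mathbb{B}_{\mathcal{H}}(p;\varepsilon)$. Legendrian knots in $\mathcal{H}\cup\{\infty\}\cong S^3$ are smooth embedded closed Legendrian curves, possibly passing through $\infty$ (then called open/infinite). For such $K$ with arc-length measure, $V(K;p)=\lim_{\varepsilon\to+0}\bigl(\int_{K\setminus\mathbb{B}_{\mathcal{H}}(p;\varepsilon)}\frac{dq}{d_{\mathcal{H}}(p,q)^2}-\frac{2}{\varepsilon}\bigr)$ and $E(K)=\int_K V(K;p)\,dp$ (for finite $K$ this equals $B_K(-2)$, the value at $-2$ of the meromorphic continuation of $\zeta\mapsto\iint_{K\times K}d_{\mathcal{H}}(p,q)^\zeta\,dp\,dq$). $\mathrm{PU}(2,1)$ is the group of CR automorphisms of $\mathcal{H}\cup\{\infty\}$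 (Möbius transformations), generated by dilations $(x,y,u)\mapsto(\lambda x,\lambda y,\lambda^2u)$, left translations, rotations $(z,u)\mapsto(e^{i\theta}z,u)$, and the inversion $\iota(z,u)=\bigl(z/(|z|^2+4iu),\,-u/(|z|^4+16u^2)\bigr)$. *)

(* Defs.v *)
From HB Require Import structures.
From mathcomp Require Import all_boot all_order all_algebra.
From mathcomp Require Import all_classical all_reals all_analysis.
Set Implicit Arguments. Unset Strict Implicit. Unset Printing Implicit Defensive.
Import Order.TTheory GRing.Theory Num.Theory.
Import numFieldNormedType.Exports.
Local Open Scope classical_set_scope.
Local Open Scope ring_scope.

Section Heisenberg.
Variable R : realType.

(* A point (x, y, u) = (z, u) of the Heisenberg group H = C x R, z = x + i y. *)
Record hpt := HPt { hx : R; hy : R; hu : R }.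

(* H u {oo} (= S^3): [None] is the point at infinity. *)
Definition S3 := option hpt.

(* group law (z,u).(z',u') = (z+z', u+u' - 1/2 Im(z conj z')),
   with Im(z conj z') = y x' - x y'. *)
Definition hmul (p q : hpt) : hpt :=
  HPt (hx p + hx q) (hy p + hy q)
      (hu p + hu q - (hy p * hx q - hx p * hy q) / 2).
Definition hinv (p : hpt) : hpt := HPt (- hx p) (- hy p) (- hu p).

Definition knorm (p : hpt) : R :=
  Num.sqrt (Num.sqrt ((hx p ^+ 2 + hy p ^+ 2) ^+ 2 + 16 * hu p ^+ 2)).
Definition kdist (p q : hpt) : R := knorm (hmul (hinv p) q).

Definition dilation (lam : R) (P : S3) : S3 :=
  match P with
  | Some p => Some (HPt (lam * hx p) (lam * hy p) (lam ^+ 2 * hu p))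
  | None => None end.
Definition ltranslation (a : hpt) (P : S3) : S3 :=
  match P with Some p => Some (hmul a p) | None => None end.
Definition rotation (th : R) (P : S3) : S3 :=
  match P with
  | Some p => Some (HPt (cos th * hx p - sin th * hy p)
                        (sin th * hx p + cos th * hy p) (hu p))
  | None => None end.
(* inversion iota(z,u) = (z/(|z|^2 + 4iu), -u/(|z|^4 + 16u^2)),
   iota(0) = oo, iota(oo) = 0.  Writing r = |z|^2, D = r^2 + 16 u^2,
   z/(r + 4iu) = z (r - 4iu)/D = ((x r + 4 u y) + i (y r - 4 u x))/D. *)
Definition inversion (P : S3) : S3 :=
  match P with
  | Some p =>
      let r := hx p ^+ 2 + hy p ^+ 2 in
      let D := r ^+ 2 + 16 * hu p ^+ 2 in
      if D == 0 then None
      else Some (HPt ((hx p * r + 4 * hu p * hy p) / D)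
                     ((hy p * r - 4 * hu p * hx p) / D)
                     (- hu p / D))
  | None => Some (HPt 0 0 0) end.

Inductive mobius_generator : (S3 -> S3) -> Prop :=
  | gen_dil (lam : R) : 0 < lam -> mobius_generator (dilation lam)
  | gen_tr (a : hpt) : mobius_generator (ltranslation a)
  | gen_rot (th : R) : mobius_generator (rotation th)
  | gen_inv : mobius_generator inversion.

(* PU(2,1): the group generated by the generators (each generator has an
   inverse that is a finite composition of generators, so the generated
   monoid is the generated group). *)
Inductive mobius : (S3 -> S3) -> Prop :=
  | mob_id : mobius id
  | mob_comp (G T : S3 -> S3) : mobius_generator G -> mobius T ->
      mobius (G \o T).

Definition smooth_on (f : R -> R) (t0 e : R) : Prop :=
  forall n t, `|t - t0| < e -> derivable (iter n (@derive1 R R) f) t 1.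

(* h is, near t0, a smooth immersed Legendrian (= horizontal) curve in H:
   h t = (X t, Y t, U t) with X, Y, U smooth, (X', Y') <> 0 and
   U' = (X Y' - Y X')/2, i.e. h' = X' X + Y' Y (horizontal). *)
Definition legendrian_near (h : R -> S3) (t0 : R) : Prop :=
  exists e : R, 0 < e /\ exists X Y U : R -> R,
    smooth_on X t0 e /\ smooth_on Y t0 e /\ smooth_on U t0 e /\
    forall t, `|t - t0| < e ->
      h t = Some (HPt (X t) (Y t) (U t)) /\
      (derive1 X t != 0 \/ derive1 Y t != 0) /\
      derive1 U t = (X t * derive1 Y t - Y t * derive1 X t) / 2.

(* g : R -> H u {oo} is an L-periodic parametrisation of a Legendrian knot:
   a smooth embedded closed Legendrian curve in H u {oo} ~ S^3, possibly
   through oo.  The smooth structure of H u {oo} is given by the two charts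
   id (on H) and the inversion (on (H \ {0}) u {oo}). *)
Definition legendrian_knot (L : R) (g : R -> S3) : Prop :=
  0 < L /\
  (forall t, g (t + L) = g t) /\
  (forall s t, 0 <= s < L -> 0 <= t < L -> g s = g t -> s = t) /\
  (forall t0, legendrian_near g t0 \/ legendrian_near (inversion \o g) t0).

(* coordinates of the curve (0 at oo; only used where the curve is finite) *)
Definition cx (g : R -> S3) (t : R) : R :=
  match g t with Some p => hx p | None => 0 end.
Definition cy (g : R -> S3) (t : R) : R :=
  match g t with Some p => hy p | None => 0 end.

(* arc-length density |g'(t)| for the horizontal curve (X, Y orthonormal) *)
Definition speed (g : R -> S3) (t : R) : R :=
  Num.sqrt (derive1 (cx g) t ^+ 2 + derive1 (cy g) t ^+ 2).

Definition Vpart (L : R) (g : R -> S3) (p : hpt) (eps : R) : \bar R :=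
  (\int[lebesgue_measure]_(t in
      [set t : R | ((0 <= t < L)%R /\
               (match g t with Some q => (eps <= kdist p q)%R | None => False end))])
     (match g t with
      | Some q => (kdist p q ^+ 2)^-1 * speed g t
      | None => 0 end)%:E)%E.

Definition Vpot (L : R) (g : R -> S3) (p : hpt) : R :=
  lim ((fun eps : R => fine (Vpart L g p eps) - 2 / eps) @ 0^'+).

Definition energy (L : R) (g : R -> S3) : \bar R :=
  (\int[lebesgue_measure]_(t in `[0%R, L[%classic)
     (match g t with
      | Some p => Vpot L g p * speed g t
      | None => 0 end)%:E)%E.

End Heisenberg.

(* Main.v *)
Require Import Defs.
From HB Require Import structures.
From mathcomp Require Import all_boot all_order all_algebra.
From mathcomp Require Import all_classical all_reals all_analysis.
From mathcomp Require Import measurable_realfun ring lra.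
Set Implicit Arguments. Unset Strict Implicit. Unset Printing Implicit Defensive.
Import Order.TTheory GRing.Theory Num.Theory.
Import numFieldNormedType.Exports.
Local Open Scope classical_set_scope.
Local Open Scope ring_scope.

(* The inversion satisfies [d(i p, i q) = d(p, q) / (|p| |q|)] and rescales the
   length element at [p] by [1 / |p| ^ 2], and the other generators are
   similarities; so every generator [G] has a factor [rho] with
   [d(G p, G q) = rho p * rho q * d(p, q)] and [|d(G p)| = rho p ^ 2 * |dp|].
   Hence [dq / d(p, q) ^ 2] is multiplied by the constant [rho p ^ -2], and only
   the regularisation of [V] at [p] has to be compared.  The key point is that
   removing the Koranyi ball [d(p, q) < eps] is asymptotically the same as removing
   the parameter interval [|t - t0| < eps / v], [v] being the speed at [p]: in the
   coordinate [y = 1 / |t - t0|] one has [dq / d ^ 2 ~ dy / v], while the two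
   endpoints of the ball are [y = v / eps +- c + o(1)], with opposite shifts on
   the two sides of [t0], which cancel.  So [V (G K; G p) = rho p ^ -2 * V (K; p)]
   and [V dp] is invariant.  None of this requires the limit defining [V]
   to exist. *)

(** * The Koranyi norm and the inversion *)

Section algebra.
Context {R : realType}.
Implicit Types p q a : hpt R.

(** The potential [Vpot] is a limit whose measurability along the knot is not established. The two
    energies are therefore compared pointwise off three parameters (the start of the period and the
    passages of the knot and of its image through infinity), and integrals are shown to ignore null
    sets for arbitrary integrands. The shifts [+- c] come from the derivative at [t0] of the
    quotient [d(p, q) / |t - t0|]. A mere limit of this quotient would only locate the ends of the
    ball up to [o(y)]; differentiability improves this to [o(1)]. It holds because horizontality
    makes the vertical coordinate cubic in [t - t0]. Bounds away from [t0], including near a passage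
    through infinity, come from sending [p] itself to infinity: [dq / d(p, q) ^ 2] is then the
    length element of another Legendrian knot, finite off [t0]. This is one reason why generators
    must be shown to preserve Legendrian knots; the delicate case is a translation at infinity,
    which has to be read in the inverted chart. *)

Definition gauge4 p : R := (hx p ^+ 2 + hy p ^+ 2) ^+ 2 + 16 * hu p ^+ 2.

(** This is [|w| ^ 2] for [w = |z| ^ 2 + 4iu], the complex quantity in which the inversion reads
    [z / w] and [w] becomes [1 / w]. *)
Lemma gauge4E p :
  gauge4 p = (hx p ^+ 2 + hy p ^+ 2) ^+ 2 + (4 * hu p) ^+ 2.
Proof. by rewrite /gauge4; ring. Qed.

Lemma gauge4_ge0 p : 0 <= gauge4 p.
Proof. by rewrite addr_ge0 ?sqr_ge0// mulr_ge0// sqr_ge0. Qed.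

Lemma knormE p : knorm p = Num.sqrt (Num.sqrt (gauge4 p)).
Proof. by []. Qed.

Lemma gauge4_eq0 p : gauge4 p = 0 -> p = HPt 0 0 0.
Proof.
case: p => x y u /eqP; rewrite /gauge4/= paddr_eq0 ?(sqr_ge0, mulr_ge0)//.
rewrite sqrf_eq0 paddr_eq0 ?sqr_ge0// !sqrf_eq0.
move=> /andP[/andP[/eqP-> /eqP->]].
by rewrite mulf_eq0 sqrf_eq0 pnatr_eq0/= => /eqP->.
Qed.

Lemma knorm_gt0 p : 0 < gauge4 p -> 0 < knorm p.
Proof. by move=> p0; rewrite knormE !sqrtr_gt0. Qed.

Lemma knormX4 p : knorm p ^+ 4 = gauge4 p.
Proof.
by rewrite -[4%N]/(2 * 2)%N exprM knormE !sqr_sqrtr ?sqrtr_ge0 ?gauge4_ge0.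
Qed.

Lemma knormM p q r : gauge4 p * gauge4 q = gauge4 r ->
  knorm p * knorm q = knorm r.
Proof. by move=> h; rewrite !knormE -!sqrtrM ?sqrtr_ge0 ?gauge4_ge0// h. Qed.

Definition inv_pt p : hpt R :=
  let r := hx p ^+ 2 + hy p ^+ 2 in
  HPt ((hx p * r + 4 * hu p * hy p) / gauge4 p)
      ((hy p * r - 4 * hu p * hx p) / gauge4 p) (- hu p / gauge4 p).

Lemma inversionE p :
  inversion (Some p) = if gauge4 p == 0 then None else Some (inv_pt p).
Proof. by []. Qed.

Lemma inversion_pt p : gauge4 p != 0 -> inversion (Some p) = Some (inv_pt p).
Proof. by rewrite inversionE => /negbTE ->. Qed.

Lemma gauge4_0 : gauge4 (HPt 0 0 0) = 0.
Proof. by rewrite /gauge4/= !expr0n/= addr0 expr0n/= add0r mulr0. Qed.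

Lemma inversion0 : inversion (Some (HPt 0 0 0)) = None :> S3 R.
Proof. by rewrite inversionE gauge4_0 eqxx. Qed.

Lemma gauge4_inv p : gauge4 p != 0 -> gauge4 (inv_pt p) = (gauge4 p)^-1.
Proof.
case: p => x y u; rewrite /inv_pt !gauge4E/= => D0.
by field.
Qed.

Lemma inv_ptK p : gauge4 p != 0 -> inv_pt (inv_pt p) = p.
Proof.
move=> D0; rewrite {1}/inv_pt gauge4_inv//.
case: p D0 => x y u; rewrite /inv_pt !gauge4E/= => D0.
by congr HPt; field; rewrite ?oner_eq0.
Qed.

Lemma inversionK : involutive (@inversion R).
Proof.
case=> [p|]; last exact: inversion0.
rewrite inversionE; case: eqP => [/gauge4_eq0 ->//|/eqP D0].
by rewrite inversion_pt ?inv_ptK// gauge4_inv// invr_eq0.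
Qed.

Lemma kdistE p q : kdist p q = knorm (hmul (hinv p) q).
Proof. by []. Qed.

Lemma kdist_inv_pt p q : gauge4 p != 0 -> gauge4 q != 0 ->
  kdist (inv_pt p) (inv_pt q) = (knorm p)^-1 * (knorm q)^-1 * kdist p q.
Proof.
move=> p0 q0.
have kp0 : knorm p != 0 by rewrite gt_eqF// knorm_gt0// lt_def p0 gauge4_ge0.
have kq0 : knorm q != 0 by rewrite gt_eqF// knorm_gt0// lt_def q0 gauge4_ge0.
(* With the norms on this side, both members are fourth roots, and a rational identity between the
   radicands suffices. *)
have -> : kdist p q = knorm p * knorm q * kdist (inv_pt p) (inv_pt q).
  rewrite !knormE !kdistE !knormE -!sqrtrM ?mulr_ge0 ?sqrtr_ge0 ?gauge4_ge0//.
  congr (Num.sqrt (Num.sqrt _)).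
  case: p p0 {kp0} => x y u; case: q q0 {kq0} => x' y' u'.
  rewrite /inv_pt !gauge4E/= => q0 p0.
  by field; rewrite p0 q0.
by field; rewrite kp0 kq0.
Qed.

Lemma kdist_hmul a p q : kdist (hmul a p) (hmul a q) = kdist p q.
Proof.
rewrite !kdistE !knormE /gauge4/=; congr (Num.sqrt (Num.sqrt _)).
by field.
Qed.

End algebra.

(** * Smooth functions on an interval *)

Section derivatives.
Context {R : realType}.
Implicit Types (f g : R -> R) (t : R).

(** Pointwise forms of the differentiation rules, with products in place of scalings: derivatives of
    explicit expressions are later assembled from them as terms. *)
Lemma isdD f g t df dg : is_derive t 1 f df -> is_derive t 1 g dg ->
  is_derive t 1 (fun x => f x + g x) (df + dg).
Proof. exact: is_deriveD. Qed.

Lemma isdB f g t df dg : is_derive t 1 f df -> is_derive t 1 g dg ->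
  is_derive t 1 (fun x => f x - g x) (df - dg).
Proof. exact: is_deriveB. Qed.

Lemma isdN f t df : is_derive t 1 f df -> is_derive t 1 (fun x => - f x) (- df).
Proof. exact: is_deriveN. Qed.

Lemma isdM f g t df dg : is_derive t 1 f df -> is_derive t 1 g dg ->
  is_derive t 1 (fun x => f x * g x) (df * g t + f t * dg).
Proof.
move=> hf hg.
have -> : df * g t + f t * dg = f t *: dg + g t *: df.
  by rewrite /GRing.scale/= addrC [df * _]mulrC.
exact: is_deriveM.
Qed.

Lemma isdV f t df : f t != 0 -> is_derive t 1 f df ->
  is_derive t 1 (fun x => (f x)^-1) (- df / f t ^+ 2).
Proof.
move=> ft0 hf.
have -> : - df / f t ^+ 2 = - f t ^- 2 *: df.
  by rewrite /GRing.scale/= mulrC mulrN mulNr.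
exact: is_deriveV.
Qed.

Lemma isd_sqrt f t df : 0 < f t -> is_derive t 1 f df ->
  is_derive t 1 (fun x => Num.sqrt (f x)) ((2 * Num.sqrt (f t))^-1 * df).
Proof. by move=> f0 hf; apply: is_derive1_comp; exact: is_derive1_sqrt. Qed.

Lemma isdX2 f t df : is_derive t 1 f df ->
  is_derive t 1 (fun x => f x ^+ 2) (2 * f t * df).
Proof.
move=> hf; have -> : 2 * f t * df = df * f t + f t * df by ring.
rewrite (_ : (fun _ => _) = (fun x => f x * f x)); first exact: isdM.
by apply/funext => x; rewrite expr2.
Qed.

Lemma isd_derive1 f t : derivable f t 1 -> is_derive t 1 f (derive1 f t).
Proof. by move=> h; rewrite derive1E; exact/derivableP. Qed.

Lemma isd_derive1E f t df : is_derive t 1 f df -> derive1 f t = df.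
Proof. by move=> h; rewrite derive1E derive_val. Qed.

Lemma isd_near f g t df : (\forall x \near t, f x = g x) ->
  is_derive t 1 f df -> is_derive t 1 g df.
Proof. by move=> fg; apply: near_eq_is_derive; rewrite ?oner_eq0. Qed.

Lemma isd_continuous f t df : is_derive t 1 f df -> {for t, continuous f}.
Proof.
by move=> [h _]; apply: differentiable_continuous; exact/derivable1_diffP.
Qed.

Lemma near_dist_lt t0 e t : `|t - t0| < e -> \forall x \near t, `|x - t0| < e.
Proof.
move=> te; have : nbhs t (ball t0 e).
  by apply: open_nbhs_nbhs; split; [exact: ball_open|rewrite /ball/= distrC].
by apply: filterS => x; rewrite /ball/= distrC.
Qed.

End derivatives.

Section smooth.
Context {R : realType}.
Variables (t0 e : R).
Implicit Types f g : R -> R.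
Local Notation B := (fun t : R => `|t - t0| < e).

(** Smoothness to finite order, so that closure under the operations can be proved by induction on
    the order. *)
Definition derivable_upto n f :=
  forall k, (k < n)%N -> forall t, B t -> derivable (iter k (@derive1 R R) f) t 1.

Lemma derivable_upto0 f : derivable_upto 0 f.
Proof. by move=> k; rewrite ltn0. Qed.

Lemma derivable_uptoS n f : derivable_upto n.+1 f <->
  (forall t, B t -> derivable f t 1) /\ derivable_upto n (derive1 f).
Proof.
split=> [h|[h0 h] [|k] kn t Bt].
- by split=> [t Bt|k kn t Bt]; [exact: (h 0)|rewrite -iterSr; exact: (h k.+1)].
- exact: h0.
- by rewrite iterSr; exact: h.
Qed.

Lemma derivable_upto_eq n f g : (forall t, B t -> f t = g t) ->
  derivable_upto n f -> derivable_upto n g.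
Proof.
elim: n f g => [|n IH] f g; first by move=> *; exact: derivable_upto0.
move=> fg /derivable_uptoS[f0 fn].
have fgd t : B t -> is_derive t 1 g (derive1 f t).
  move=> Bt; apply: isd_near (isd_derive1 (f0 _ Bt)).
  by apply: filterS (near_dist_lt Bt) => x; exact: fg.
apply/derivable_uptoS; split=> [t /fgd[]//|].
by apply: IH fn => t Bt; rewrite (isd_derive1E (fgd _ Bt)).
Qed.

Lemma derivable_uptoW n f : derivable_upto n.+1 f -> derivable_upto n f.
Proof. by move=> h k kn; apply: h; rewrite ltnS ltnW. Qed.

Lemma derivable_upto_cst n c : derivable_upto n (fun=> c).
Proof.
elim: n c => [|n IH] c; first exact: derivable_upto0.
apply/derivable_uptoS; split=> [t _|].
  exact: derivable_cst.
rewrite (_ : derive1 _ = fun=> 0); first exact: IH.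
by apply/funext => t; exact: derive1_cst.
Qed.

Lemma derivable_uptoD n f g : derivable_upto n f -> derivable_upto n g ->
  derivable_upto n (fun t => f t + g t).
Proof.
elim: n f g => [|n IH] f g; first by move=> *; exact: derivable_upto0.
move=> /derivable_uptoS[f0 fn] /derivable_uptoS[g0 gn].
have d t : B t -> is_derive t 1 (fun t => f t + g t) (derive1 f t + derive1 g t).
  by move=> Bt; apply: isdD; apply: isd_derive1; [exact: f0|exact: g0].
apply/derivable_uptoS; split=> [t /d[]//|].
apply: derivable_upto_eq (IH _ _ fn gn) => t /d dt.
by rewrite (isd_derive1E dt).
Qed.

Lemma derivable_uptoM n f g : derivable_upto n f -> derivable_upto n g ->
  derivable_upto n (fun t => f t * g t).
Proof.
elim: n f g => [|n IH] f g; first by move=> *; exact: derivable_upto0.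
move=> hf hg.
have /derivable_uptoS[f0 fn] := hf; have /derivable_uptoS[g0 gn] := hg.
have d t : B t -> is_derive t 1 (fun t => f t * g t)
    (derive1 f t * g t + f t * derive1 g t).
  by move=> Bt; apply: isdM; apply: isd_derive1; [exact: f0|exact: g0].
apply/derivable_uptoS; split=> [t /d[]//|].
apply: (@derivable_upto_eq _ (fun t => derive1 f t * g t + f t * derive1 g t)).
  by move=> t /d dt; rewrite (isd_derive1E dt).
by apply: derivable_uptoD; [apply: (IH _ _ fn)|apply: (IH _ _ _ gn)];
  exact: derivable_uptoW.
Qed.

(** The derivative of [1 / f] is built from [f'] and from [1 / f] itself at one order less; hence an
    induction on the order with [f] fixed. *)
Lemma derivable_uptoV n f : (forall t, B t -> f t != 0) ->
  derivable_upto n f -> derivable_upto n (fun t => (f t)^-1).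
Proof.
move=> f_neq0; elim: n => [|n IH] hf; first exact: derivable_upto0.
have /derivable_uptoS[f0 fn] := hf.
have d t : B t -> is_derive t 1 (fun t => (f t)^-1) (- derive1 f t / f t ^+ 2).
  by move=> Bt; apply: isdV; [exact: f_neq0|apply: isd_derive1; exact: f0].
apply/derivable_uptoS; split=> [t /d[]//|].
have Vn := IH (derivable_uptoW hf).
apply: (@derivable_upto_eq _
    (fun t => - 1 * derive1 f t * ((f t)^-1 * (f t)^-1))).
  by move=> t /d dt; rewrite (isd_derive1E dt) -exprVn mulN1r.
apply: derivable_uptoM; last exact: derivable_uptoM.
by apply: derivable_uptoM fn; exact: derivable_upto_cst.
Qed.

Lemma smooth_onP f : smooth_on f t0 e <-> forall n, derivable_upto n f.
Proof. by split=> [h n k _|h n]; [exact: h|exact: (h n.+1)]. Qed.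

Lemma smooth_on_cst c : smooth_on (fun=> c) t0 e.
Proof. by apply/smooth_onP => n; exact: derivable_upto_cst. Qed.

Lemma smooth_onD f g : smooth_on f t0 e -> smooth_on g t0 e ->
  smooth_on (fun t => f t + g t) t0 e.
Proof.
move=> /smooth_onP hf /smooth_onP hg.
by apply/smooth_onP => n; exact: derivable_uptoD.
Qed.

Lemma smooth_onM f g : smooth_on f t0 e -> smooth_on g t0 e ->
  smooth_on (fun t => f t * g t) t0 e.
Proof.
move=> /smooth_onP hf /smooth_onP hg.
by apply/smooth_onP => n; exact: derivable_uptoM.
Qed.

Lemma smooth_onN f : smooth_on f t0 e -> smooth_on (fun t => - f t) t0 e.
Proof.
move=> /smooth_onP hf; apply/smooth_onP => n.
apply: (@derivable_upto_eq _ (fun t => - 1 * f t)) => [t _|].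
  by rewrite mulN1r.
by apply: derivable_uptoM (hf n); exact: derivable_upto_cst.
Qed.

Lemma smooth_onX f n : smooth_on f t0 e -> smooth_on (fun t => f t ^+ n) t0 e.
Proof.
move=> hf; elim: n => [|n IH].
  exact: smooth_on_cst.
rewrite (_ : (fun _ => _) = (fun t => f t * f t ^+ n)); first exact: smooth_onM.
by apply/funext => t; rewrite exprS.
Qed.

Lemma smooth_onV f : (forall t, B t -> f t != 0) ->
  smooth_on f t0 e -> smooth_on (fun t => (f t)^-1) t0 e.
Proof.
move=> f0 /smooth_onP hf.
by apply/smooth_onP => n; exact: derivable_uptoV.
Qed.

Lemma smooth_on_derive1 f : smooth_on f t0 e -> smooth_on (derive1 f) t0 e.
Proof. by move=> h n t Bt; rewrite -iterSr; exact: (h n.+1). Qed.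

Lemma smooth_on_isd f t : smooth_on f t0 e -> B t ->
  is_derive t 1 f (derive1 f t).
Proof. by move=> h Bt; apply: isd_derive1; exact: (h 0). Qed.

End smooth.

Lemma smooth_on_sub {R : realType} (f : R -> R) t0 e t1 d :
  (forall t, `|t - t1| < d -> `|t - t0| < e) ->
  smooth_on f t0 e -> smooth_on f t1 d.
Proof. by move=> h s n t /h; exact: s. Qed.

(** * Action of the generators on Legendrian curves *)

Section contact.
Context {R : realType}.
Implicit Types (X Y U : R -> R) (g : R -> S3 R) (p a : hpt R).

Definition legendrian_curve X Y U (t0 e : R) :=
  [/\ smooth_on X t0 e, smooth_on Y t0 e, smooth_on U t0 e &
    forall t, `|t - t0| < e ->
      (derive1 X t != 0 \/ derive1 Y t != 0) /\
      derive1 U t = (X t * derive1 Y t - Y t * derive1 X t) / 2].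

Lemma legendrian_nearP g t0 : legendrian_near g t0 <->
  exists e X Y U, [/\ 0 < e, legendrian_curve X Y U t0 e &
    forall t, `|t - t0| < e -> g t = Some (HPt (X t) (Y t) (U t))].
Proof.
split=> [[e [e0 [X [Y [U [hX [hY [hU h]]]]]]]]|[e [X [Y [U [e0 [hX hY hU h] hg]]]]]].
  by exists e, X, Y, U; split=> // [|t /h[]//]; split=> // t /h[].
by exists e; split=> //; exists X, Y, U; do 3!split=> //; move=> t te;
  split; [exact: hg|exact: h].
Qed.

Lemma derive1_near X Y t : (\forall x \near t, X x = Y x) ->
  derive1 X t = derive1 Y t.
Proof. by move=> XY; rewrite !derive1E; exact: near_eq_derive. Qed.

Lemma speedE g X Y U t : (\forall s \near t, g s = Some (HPt (X s) (Y s) (U s))) ->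
  speed g t = Num.sqrt (derive1 X t ^+ 2 + derive1 Y t ^+ 2).
Proof.
move=> gE; rewrite /speed; congr (Num.sqrt (_ ^+ 2 + _ ^+ 2));
  apply: derive1_near; apply: filterS gE => s gs; by rewrite /cx /cy gs.
Qed.

(* [F] acts on horizontal curves through [p] as a contact map with conformal
   factor [k ^+ 2] at [p]. *)
Definition contact_at (F : S3 R -> S3 R) p (k : R) :=
  0 < k /\ forall g t0, g t0 = Some p -> legendrian_near g t0 ->
    legendrian_near (F \o g) t0 /\ speed (F \o g) t0 = k ^+ 2 * speed g t0.

Lemma sum_sqr_neq0 (x y : R) : x ^+ 2 + y ^+ 2 != 0 <-> x != 0 \/ y != 0.
Proof.
rewrite paddr_eq0 ?sqr_ge0// !sqrf_eq0 negb_and.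
by split=> [/orP//|h]; apply/orP.
Qed.

(* [M1 + i M2] is the complex factor by which [F] multiplies the horizontal
   velocity; [F] is given by [Fx], [Fy], [Fu] where the denominator [D] is nonzero. *)
Lemma contact_atI (F : S3 R -> S3 R) (Fx Fy Fu : R -> R -> R -> R)
  (M1 M2 : R -> R -> R -> R) (D : R -> R -> R -> R) p (k : R) :
  (forall X Y U (t0 e : R), smooth_on X t0 e -> smooth_on Y t0 e ->
    smooth_on U t0 e -> (forall t, `|t - t0| < e -> D (X t) (Y t) (U t) != 0) ->
    [/\ smooth_on (fun t : R => Fx (X t) (Y t) (U t)) t0 e,
        smooth_on (fun t : R => Fy (X t) (Y t) (U t)) t0 e &
        smooth_on (fun t : R => Fu (X t) (Y t) (U t)) t0 e]) ->
  (forall X Y U (t0 e : R), smooth_on X t0 e -> smooth_on Y t0 e ->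
    smooth_on U t0 e -> smooth_on (fun t : R => D (X t) (Y t) (U t)) t0 e) ->
  (forall x y u, D x y u != 0 ->
    F (Some (HPt x y u)) = Some (HPt (Fx x y u) (Fy x y u) (Fu x y u))) ->
  (forall X Y U (t x' y' : R), D (X t) (Y t) (U t) != 0 ->
    is_derive t 1 X x' -> is_derive t 1 Y y' ->
    is_derive t 1 U ((X t * y' - Y t * x') / 2) ->
    let m1 := M1 (X t) (Y t) (U t) in let m2 := M2 (X t) (Y t) (U t) in
    let fx' := m1 * x' - m2 * y' in let fy' := m2 * x' + m1 * y' in
    [/\ is_derive t 1 (fun t : R => Fx (X t) (Y t) (U t)) fx',
        is_derive t 1 (fun t : R => Fy (X t) (Y t) (U t)) fy' &
        is_derive t 1 (fun t : R => Fu (X t) (Y t) (U t))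
          ((Fx (X t) (Y t) (U t) * fy' - Fy (X t) (Y t) (U t) * fx') / 2)]) ->
  (forall x y u, D x y u != 0 -> M1 x y u ^+ 2 + M2 x y u ^+ 2 != 0) ->
  D (hx p) (hy p) (hu p) != 0 -> 0 < k ->
  M1 (hx p) (hy p) (hu p) ^+ 2 + M2 (hx p) (hy p) (hu p) ^+ 2 = k ^+ 4 ->
  contact_at F p k.
Proof.
move=> Fs Ds FE Fd M0 Dp k0 Mk; split=> // g t0 gt0 /legendrian_nearP.
move=> [e0 [X [Y [U [e0_gt0 [hX0 hY0 hU0 h0] hg0]]]]].
have pE : p = HPt (X t0) (Y t0) (U t0).
  by have := hg0 t0; rewrite subrr normr0 gt0 => /(_ e0_gt0)[].
rewrite pE/= in Dp Mk.
have Dc : {for t0, continuous (fun t : R => D (X t) (Y t) (U t))}.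
  apply: isd_continuous; apply: smooth_on_isd (Ds _ _ _ _ _ hX0 hY0 hU0) _.
  by rewrite subrr normr0.
have [e [e_gt0 ee0 De]] : exists e, [/\ 0 < e, e <= e0 &
    forall t, `|t - t0| < e -> D (X t) (Y t) (U t) != 0].
  have nz : \forall t \near t0, D (X t) (Y t) (U t) != 0 by exact: cvgr_neq0 Dc Dp.
  move/nbhs_ballP : nz => [d /= d0 hd]; exists (Num.min e0 d).
  rewrite lt_min e0_gt0 d0 ge_min lexx; split=> // t.
  by rewrite lt_min => /andP[_ td]; apply: hd; rewrite /ball/= distrC.
have Be t : `|t - t0| < e -> `|t - t0| < e0 by move=> /lt_le_trans; apply.
have [hX hY hU] : [/\ smooth_on X t0 e, smooth_on Y t0 e & smooth_on U t0 e].
  by split; [move: hX0|move: hY0|move: hU0]; apply: smooth_on_sub.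
have [sx sy su] := Fs _ _ _ _ _ hX hY hU De.
have d t : `|t - t0| < e -> _ :=
  fun te => Fd X Y U t _ _ (De _ te) (smooth_on_isd hX te) (smooth_on_isd hY te).
have {}d t : `|t - t0| < e -> [/\
    derive1 (fun t : R => Fx (X t) (Y t) (U t)) t =
      M1 (X t) (Y t) (U t) * derive1 X t - M2 (X t) (Y t) (U t) * derive1 Y t,
    derive1 (fun t : R => Fy (X t) (Y t) (U t)) t =
      M2 (X t) (Y t) (U t) * derive1 X t + M1 (X t) (Y t) (U t) * derive1 Y t &
    derive1 (fun t : R => Fu (X t) (Y t) (U t)) t =
      (Fx (X t) (Y t) (U t) * derive1 (fun t : R => Fy (X t) (Y t) (U t)) t -
       Fy (X t) (Y t) (U t) * derive1 (fun t : R => Fx (X t) (Y t) (U t)) t) / 2].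
  move=> te; have := d _ te; have [_ <-] := h0 _ (Be _ te).
  move=> /(_ (smooth_on_isd hU te))[dx dy du].
  by rewrite (isd_derive1E dx) (isd_derive1E dy) (isd_derive1E du).
have hFg t : `|t - t0| < e -> (F \o g) t =
    Some (HPt (Fx (X t) (Y t) (U t)) (Fy (X t) (Y t) (U t)) (Fu (X t) (Y t) (U t))).
  by move=> te; rewrite /= (hg0 _ (Be _ te)) FE//; exact: De.
have t0e : `|t0 - t0| < e by rewrite subrr normr0.
have t0e0 : `|t0 - t0| < e0 by rewrite subrr normr0.
split.
  apply/legendrian_nearP; exists e; do 3!eexists; split; [exact: e_gt0| |exact: hFg].
  split; [exact: sx|exact: sy|exact: su|move=> t te].
  have [dx dy du] := d _ te; split; last exact: du.
  apply/sum_sqr_neq0; rewrite dx dy.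
  set m1 := M1 _ _ _; set m2 := M2 _ _ _.
  (* Multiplicativity of the complex modulus, for [m1 + i m2] times the velocity. *)
  rewrite (_ : _ ^+ 2 + _ = (m1 ^+ 2 + m2 ^+ 2) *
    (derive1 X t ^+ 2 + derive1 Y t ^+ 2)); last by ring.
  rewrite mulf_neq0//; first by apply: M0; exact: De.
  by apply/sum_sqr_neq0; case: (h0 _ (Be _ te)).
have [dx dy _] := d _ t0e.
rewrite (speedE (filterS hFg (near_dist_lt t0e))).
rewrite (speedE (filterS hg0 (near_dist_lt t0e0))) dx dy.
set m1 := M1 _ _ _ in Mk *; set m2 := M2 _ _ _ in Mk *.
rewrite (_ : _ ^+ 2 + _ = k ^+ 4 *
    (derive1 X t0 ^+ 2 + derive1 Y t0 ^+ 2)); last by rewrite -Mk; ring.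
rewrite sqrtrM ?exprn_ge0 ?ltW//; congr (_ * _).
by rewrite -[4%N]/(2 * 2)%N exprM sqrtr_sqr ger0_norm// sqr_ge0.
Qed.

Lemma contact_ltranslation a p : contact_at (ltranslation a) p 1.
Proof.
pose fx := fun x y u : R => hx a + x.
pose fy := fun x y u : R => hy a + y.
pose fu := fun x y u : R => hu a + u + - (hy a * x + - (hx a * y)) * 2^-1.
apply: (@contact_atI _ fx fy fu (fun _ _ _ => 1) (fun _ _ _ => 0) (fun _ _ _ => 1)).
- move=> X Y U t0 e hX hY hU _; split; rewrite /fx /fy /fu.
  + by apply: smooth_onD hX; exact: smooth_on_cst.
  + by apply: smooth_onD hY; exact: smooth_on_cst.
  + apply: smooth_onD; first by apply: smooth_onD hU; exact: smooth_on_cst.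
    apply: smooth_onM; last exact: smooth_on_cst.
    apply: smooth_onN; apply: smooth_onD; last apply: smooth_onN.
      by apply: smooth_onM hX; exact: smooth_on_cst.
    by apply: smooth_onM hY; exact: smooth_on_cst.
- by move=> *; exact: smooth_on_cst.
- by move=> x y u _; rewrite /= /hmul/= /fx /fy /fu; congr (Some (HPt _ _ _)); ring.
- move=> X Y U t x' y' _ dX dY dU /=; rewrite /fx /fy /fu.
  split.
  + by apply: is_derive_eq (isdD (is_derive_cst (hx a) t 1) dX) _; ring.
  + by apply: is_derive_eq (isdD (is_derive_cst (hy a) t 1) dY) _; ring.
  + apply: is_derive_eq (isdD (isdD (is_derive_cst (hu a) t 1) dU)
      (isdM (isdN (isdD (isdM (is_derive_cst (hy a) t 1) dX)
        (isdN (isdM (is_derive_cst (hx a) t 1) dY)))) (is_derive_cst (2^-1 : R) t 1))) _.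
    rewrite /=; by field.
- by move=> *; rewrite expr1n expr0n addr0 oner_neq0.
- exact: oner_neq0.
- exact: ltr01.
- by rewrite !expr1n expr0n addr0.
Qed.

(** Multiplication of [z] by [c + is], which covers dilations and rotations together; the factor
    [|c + is| ^ 2] on [u] makes it a group automorphism when [c + is] is nonzero. *)
Definition cmul (c s : R) (P : S3 R) : S3 R :=
  match P with
  | Some p => Some (HPt (c * hx p - s * hy p) (s * hx p + c * hy p)
                        ((c ^+ 2 + s ^+ 2) * hu p))
  | None => None end.

Lemma contact_cmul c s p k : 0 < k -> c ^+ 2 + s ^+ 2 = k ^+ 4 ->
  contact_at (cmul c s) p k.
Proof.
move=> k0 csk.
pose fx := fun x y u : R => c * x + - (s * y).
pose fy := fun x y u : R => s * x + c * y.
pose fu := fun x y u : R => (c ^+ 2 + s ^+ 2) * u.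
apply: (@contact_atI _ fx fy fu (fun _ _ _ => c) (fun _ _ _ => s) (fun _ _ _ => 1)).
- move=> X Y U t0 e hX hY hU _; split; rewrite /fx /fy /fu.
  + apply: smooth_onD; last apply: smooth_onN.
      by apply: smooth_onM hX; exact: smooth_on_cst.
    by apply: smooth_onM hY; exact: smooth_on_cst.
  + apply: smooth_onD.
      by apply: smooth_onM hX; exact: smooth_on_cst.
    by apply: smooth_onM hY; exact: smooth_on_cst.
  + by apply: smooth_onM hU; exact: smooth_on_cst.
- by move=> *; exact: smooth_on_cst.
- by move=> x y u _; rewrite /= /fx /fy /fu.
- move=> X Y U t x' y' _ dX dY dU /=; rewrite /fx /fy /fu.
  have dc := is_derive_cst c t 1; have ds := is_derive_cst s t 1.
  split.
  + by apply: is_derive_eq (isdD (isdM dc dX) (isdN (isdM ds dY))) _; rewrite /=; ring.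
  + by apply: is_derive_eq (isdD (isdM ds dX) (isdM dc dY)) _; rewrite /=; ring.
  + apply: is_derive_eq (isdM (is_derive_cst (c ^+ 2 + s ^+ 2) t 1) dU) _.
    rewrite /=; by field.
- by move=> *; rewrite csk expf_neq0// gt_eqF.
- exact: oner_neq0.
- exact: k0.
- exact: csk.
Qed.

(* With [w = |z|^2 + 4iu] one has [w' = 2 conj(z) z'] along a horizontal curve,
   hence [(z / w)' = - conj(w) / w ^ 2 * z'], and
   [conj(w) / w ^ 2 = conj(w) ^ 3 / |w| ^ 4]. *)
Lemma contact_inversion p : gauge4 p != 0 ->
  contact_at (@inversion R) p (knorm p)^-1.
Proof.
move=> p0.
pose r := fun x y : R => x ^+ 2 + y ^+ 2.
pose D := fun x y u : R => r x y ^+ 2 + (4 * u) ^+ 2.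
pose fx := fun x y u : R => (x * r x y + (4 * u) * y) * (D x y u)^-1.
pose fy := fun x y u : R => (y * r x y + - ((4 * u) * x)) * (D x y u)^-1.
pose fu := fun x y u : R => - u * (D x y u)^-1.
pose m1 := fun x y u : R => - (r x y ^+ 3 - 3 * r x y * (4 * u) ^+ 2) / D x y u ^+ 2.
pose m2 := fun x y u : R => - ((4 * u) ^+ 3 - 3 * r x y ^+ 2 * (4 * u)) / D x y u ^+ 2.
have DE q : D (hx q) (hy q) (hu q) = gauge4 q by rewrite gauge4E.
have hr X Y (t0 e : R) : smooth_on X t0 e -> smooth_on Y t0 e ->
    smooth_on (fun t : R => r (X t) (Y t)) t0 e.
  by move=> hX hY; apply: smooth_onD; exact: smooth_onX.
have h4 U (t0 e : R) : smooth_on U t0 e -> smooth_on (fun t : R => 4 * U t) t0 e.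
  by move=> hU; apply: smooth_onM hU; exact: smooth_on_cst.
have hD X Y U (t0 e : R) : smooth_on X t0 e -> smooth_on Y t0 e ->
    smooth_on U t0 e -> smooth_on (fun t : R => D (X t) (Y t) (U t)) t0 e.
  move=> hX hY hU; apply: smooth_onD; apply: smooth_onX; first exact: hr.
  exact: h4.
apply: (@contact_atI _ fx fy fu m1 m2 D).
- move=> X Y U t0 e hX hY hU D0.
  have hV := smooth_onV D0 (hD _ _ _ _ _ hX hY hU).
  have h4U := h4 _ _ _ hU; have hR := hr _ _ _ _ hX hY.
  split.
  + apply: smooth_onM hV; apply: smooth_onD; first exact: smooth_onM.
    exact: smooth_onM.
  + apply: smooth_onM hV; apply: smooth_onD; first exact: smooth_onM.
    apply: smooth_onN; exact: smooth_onM.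
  + apply: smooth_onM hV; exact: smooth_onN.
- exact: hD.
- move=> x y u; rewrite (DE (HPt x y u)) => D0; rewrite inversion_pt// /inv_pt.
  by rewrite -(DE (HPt x y u)).
- move=> X Y U t x' y' D0 dX dY dU /=.
  have dr : is_derive t 1 (fun t : R => r (X t) (Y t)) _ := isdD (isdX2 dX) (isdX2 dY).
  have d4 := isdM (is_derive_cst (4 : R) t 1) dU.
  have dD : is_derive t 1 (fun t : R => D (X t) (Y t) (U t)) _ :=
    isdD (isdX2 dr) (isdX2 d4).
  have dV := @isdV R (fun t => D (X t) (Y t) (U t)) t _ D0 dD.
  split.
  + apply: is_derive_eq (isdM (isdD (isdM dX dr) (isdM d4 dY)) dV) _.
    move: D0; rewrite /m1 /m2 /D /r /= => D0; by field.
  + apply: is_derive_eq (isdM (isdD (isdM dY dr) (isdN (isdM d4 dX))) dV) _.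
    move: D0; rewrite /m1 /m2 /D /r /= => D0; by field.
  + apply: is_derive_eq (isdM (isdN dU) dV) _.
    move: D0; rewrite /fx /fy /m1 /m2 /D /r /= => D0; by field.
- move=> x y u D0; rewrite (_ : _ ^+ 2 + _ = (D x y u)^-1) ?invr_eq0//.
  by move: D0; rewrite /m1 /m2 /D /r /= => D0; field.
- by rewrite DE.
- by rewrite invr_gt0 knorm_gt0// lt_def p0 gauge4_ge0.
- rewrite exprVn knormX4 -DE; move: p0; rewrite -DE.
  by rewrite /m1 /m2 /D /r /= => D0; field.
Qed.

End contact.

(** * Mobius generators preserve Legendrian knots *)

Section conj_translation.
Context {R : realType}.
Implicit Types (g : R -> S3 R) (p q a h : hpt R).

Lemma contact_at_comp (F G : S3 R -> S3 R) p q k l : F (Some p) = Some q ->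
  contact_at F p k -> contact_at G q l -> contact_at (G \o F) p (l * k).
Proof.
move=> Fp [k0 hF] [l0 hG]; split; first exact: mulr_gt0.
move=> g t0 gt0 lg.
have [lF sF] := hF _ _ gt0 lg.
have Fgt0 : (F \o g) t0 = Some q by rewrite /= gt0.
have [lG sG] := hG _ _ Fgt0 lF.
by split=> //; rewrite [LHS]sG sF exprMn mulrA.
Qed.

(* Translations fix infinity, so their smoothness there is that of [i o tau_a o i]
   at the origin.  With [A = |alpha|^2 + 4is] for [a = (alpha, s)] and
   [m = i (a^-1)], this map equals [tau_(i a) o zeta o i o tau_(m^-1)] with
   [zeta = - conj(A) / A^2], which stays finite near the origin; [conj_re] and
   [conj_im] are the real and imaginary parts of [zeta]. *)
Definition conj_re a : R :=
  let r := hx a ^+ 2 + hy a ^+ 2 in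
  - (r ^+ 3 - 3 * r * (4 * hu a) ^+ 2) / gauge4 a ^+ 2.
Definition conj_im a : R :=
  let r := hx a ^+ 2 + hy a ^+ 2 in
  - ((4 * hu a) ^+ 3 - 3 * r ^+ 2 * (4 * hu a)) / gauge4 a ^+ 2.

Lemma gauge4_hinv a : gauge4 (hinv a) = gauge4 a.
Proof. by rewrite /gauge4/= !sqrrN. Qed.

(** The distance formula for the inversion, between [m = i (a^-1)] and [h], in fourth powers. It
    shows that [i] sends [a . i h] and [m^-1 . h] to infinity for the same [h]. *)
Lemma gauge4_conj a h : gauge4 a != 0 -> gauge4 h != 0 ->
  gauge4 (hmul a (inv_pt h)) * gauge4 h =
  gauge4 a * gauge4 (hmul (hinv (inv_pt (hinv a))) h).
Proof.
rewrite /inv_pt gauge4_hinv !gauge4E/=.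
case: a => a b s; case: h => x y u /= a0 h0.
by field; rewrite a0 h0.
Qed.


Let r p := hx p ^+ 2 + hy p ^+ 2.
(* [Q1 + i Q2 = 1 + 2 conj(alpha) z + A w], where [w = |z|^2 + 4iu]. *)
Let Q1 a h := 1 + 2 * (hx a * hx h + hy a * hy h) + r a * r h
  - (4 * hu a) * (4 * hu h).
Let Q2 a h := 2 * (hx a * hy h - hy a * hx h) + r a * (4 * hu h)
  + (4 * hu a) * r h.

(** From [w (p q) = w p + w q + 2 conj(z_p) z_q] and [w (i h) = 1 / w h], the value of [w] at
    [a . i h] is [(Q1 + i Q2) / w h]. *)
Lemma gauge4_hmul_inv a h : gauge4 h != 0 ->
  gauge4 (hmul a (inv_pt h)) = (Q1 a h ^+ 2 + Q2 a h ^+ 2) / gauge4 h.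
Proof.
rewrite /inv_pt !gauge4E/= /Q1 /Q2 /r; case: a => a b s; case: h => x y u /= h0.
by field; rewrite h0.
Qed.

(** Dividing [alpha + z / w] by [(Q1 + i Q2) / w] cancels [w]: the first two coordinates are those
    of [(alpha w + z) / (Q1 + i Q2)], and [zx + i zy = alpha w + z]. *)
Lemma inv_hmul_inv a h : gauge4 h != 0 -> Q1 a h ^+ 2 + Q2 a h ^+ 2 != 0 ->
  inv_pt (hmul a (inv_pt h)) =
  let Q := Q1 a h ^+ 2 + Q2 a h ^+ 2 in
  let zx := hx a * r h - hy a * (4 * hu h) + hx h in
  let zy := hx a * (4 * hu h) + hy a * r h + hy h in
  HPt ((zx * Q1 a h + zy * Q2 a h) / Q) ((zy * Q1 a h - zx * Q2 a h) / Q)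
   (- (hu a * gauge4 h - hu h - (hy a * (hx h * r h + 4 * hu h * hy h) -
    hx a * (hy h * r h - 4 * hu h * hx h)) / 2) / Q).
Proof.
move=> h0 Q0; rewrite {1}/inv_pt gauge4_hmul_inv//=.
set q := Q1 a h ^+ 2 + _ in Q0 *.
move: h0; rewrite gauge4E /Q1 /Q2 /r.
case: a @q Q0 => a b s; case: h => x y u /= Q0 h0.
congr HPt.
all: by field; rewrite Q0 h0.
Qed.

(** With [m = i (a^-1)], the value of [w] at [m^-1 . h] is [(Q1 + i Q2) / A]: the same numerator as
    at [a . i h]. *)
Lemma gauge4_hinv_inv a h : gauge4 a != 0 ->
  gauge4 (hmul (hinv (inv_pt (hinv a))) h) =
    (Q1 a h ^+ 2 + Q2 a h ^+ 2) / gauge4 a.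
Proof.
move=> a0; rewrite /inv_pt gauge4_hinv !gauge4E/= /Q1 /Q2 /r.
move: a0; rewrite gauge4E; case: a => a b s; case: h => x y u /= a0.
by field; rewrite a0.
Qed.

(** Here [m^-1] has [z]-coordinate [alpha / conj(A)], so [zx + i zy = |A| ^ 2 z + alpha A] and
    [wx + i wy = A conj(Q1 + i Q2)]. *)
Lemma inv_hinv_inv a h : gauge4 a != 0 -> Q1 a h ^+ 2 + Q2 a h ^+ 2 != 0 ->
  inv_pt (hmul (hinv (inv_pt (hinv a))) h) =
  let Q := Q1 a h ^+ 2 + Q2 a h ^+ 2 in
  let zx := hx h * gauge4 a + (hx a * r a - 4 * hu a * hy a) in
  let zy := hy h * gauge4 a + (hy a * r a + 4 * hu a * hx a) in
  let wx := r a * Q1 a h + 4 * hu a * Q2 a h in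
  let wy := 4 * hu a * Q1 a h - r a * Q2 a h in
  HPt ((zx * wx - zy * wy) / gauge4 a / Q) ((zx * wy + zy * wx) / gauge4 a / Q)
    (- (hu h * gauge4 a - hu a - ((hy a * r a + 4 * hu a * hx a) * hx h
       - (hx a * r a - 4 * hu a * hy a) * hy h) / 2) / Q).
Proof.
move=> a0 Q0; rewrite {1}/inv_pt gauge4_hinv_inv//=.
set q := Q1 a h ^+ 2 + _ in Q0 *.
move: a0; rewrite /inv_pt gauge4_hinv gauge4E.
case: a @q Q0 => a b s; case: h => x y u /= Q0 a0.
move: Q0; rewrite /Q1 /Q2 /r/= => Q0.
by congr HPt; field; rewrite Q0 a0.
Qed.

(** In the [z]-coordinate this is [(alpha w + z) / Q = alpha / A - (alpha + conj(A) z) / (A Q)] with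
    [Q = Q1 + i Q2], which follows from [2 |alpha| ^ 2 - conj(A) = A]. *)
Lemma conj_pt a h : gauge4 a != 0 -> gauge4 h != 0 ->
  let l := hmul (hinv (inv_pt (hinv a))) h in gauge4 l != 0 ->
  inv_pt (hmul a (inv_pt h)) =
  hmul (inv_pt a) (HPt (conj_re a * hx (inv_pt l) - conj_im a * hy (inv_pt l))
    (conj_im a * hx (inv_pt l) + conj_re a * hy (inv_pt l))
    ((conj_re a ^+ 2 + conj_im a ^+ 2) * hu (inv_pt l))).
Proof.
move=> a0 h0 l l0.
have Q0 : Q1 a h ^+ 2 + Q2 a h ^+ 2 != 0.
  move: l0; rewrite /l gauge4_hinv_inv// mulf_eq0 invr_eq0 (negbTE a0) orbF.
  by [].
rewrite inv_hmul_inv// /l inv_hinv_inv//= /conj_re /conj_im /inv_pt /hmul.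
move: a0 h0 Q0 {l0 l}; rewrite !gauge4E /Q1 /Q2 /r.
case: a => a b s; case: h => x y u /= a0 h0 Q0.
congr HPt.
all: by field; rewrite ?Q0 ?h0 ?a0.
Qed.

Lemma hmul0 a : hmul a (HPt 0 0 0) = a.
Proof. by case: a => a b s; rewrite /hmul/=; congr HPt; ring. Qed.

Lemma inversion_ltranslation a (P : S3 R) : gauge4 a != 0 ->
  inversion (ltranslation a (inversion P)) =
  ltranslation (inv_pt a) (cmul (conj_re a) (conj_im a)
    (inversion (ltranslation (hinv (inv_pt (hinv a))) P))).
Proof.
move=> a0; case: P => [h|]; last first.
  rewrite [inversion None]/= [ltranslation a _]/= hmul0 inversion_pt//=.
  by rewrite !mulr0 subr0 addr0 hmul0.
rewrite [inversion (Some h)]inversionE; case: ifPn => [/eqP/gauge4_eq0 ->|h0].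
  (* At the origin the left side is [i oo = 0], because translations fix infinity; the right side
     stays finite there and is evaluated directly. *)
  have Q0 : Q1 a (HPt 0 0 0) ^+ 2 + Q2 a (HPt 0 0 0) ^+ 2 = 1.
    by rewrite /Q1 /Q2 /r/=; ring.
  have l0 : gauge4 (hmul (hinv (inv_pt (hinv a))) (HPt 0 0 0)) != 0.
    by rewrite gauge4_hinv_inv// Q0 div1r invr_eq0.
  rewrite [ltranslation _ (Some _)]/= inversion_pt// inv_hinv_inv// ?Q0 ?oner_neq0//.
  rewrite /= /hmul/= /Q1 /Q2 /r /conj_re /conj_im /inv_pt /=; congr Some.
  move: a0; rewrite gauge4E; case: a {Q0 l0} => a b s /= a0.
  by congr HPt; field.
rewrite [ltranslation _ (Some (inv_pt h))]/= [ltranslation _ (Some h)]/=.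
have [l0|l0] := eqVneq (gauge4 (hmul (hinv (inv_pt (hinv a))) h)) 0.
  rewrite !inversionE l0 eqxx; have := gauge4_conj a0 h0; rewrite l0 mulr0.
  by move=> /eqP; rewrite mulf_eq0 (negbTE h0) orbF => ->.
have k0 : gauge4 (hmul a (inv_pt h)) != 0.
  have := gauge4_conj a0 h0 => e; apply: contra_neq l0 => k0.
  by apply: (mulfI a0); rewrite -e k0 mul0r mulr0.
by rewrite !inversion_pt// conj_pt.
Qed.

(** Multiplication by [zeta = c + is] scales [w] by [|zeta| ^ 2], hence [z / w] by
    [zeta / |zeta| ^ 2 = 1 / conj(zeta)]. *)
Lemma inversion_cmul c s (P : S3 R) : c ^+ 2 + s ^+ 2 != 0 ->
  inversion (cmul c s P) =
  cmul (c / (c ^+ 2 + s ^+ 2)) (s / (c ^+ 2 + s ^+ 2)) (inversion P).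
Proof.
move=> cs0; case: P => [p|]; last first.
  by rewrite /= !mulr0 subr0 addr0.
have e : gauge4 (HPt (c * hx p - s * hy p) (s * hx p + c * hy p)
    ((c ^+ 2 + s ^+ 2) * hu p)) = (c ^+ 2 + s ^+ 2) ^+ 2 * gauge4 p.
  by rewrite !gauge4E/=; ring.
rewrite [cmul _ _ (Some p)]/= !inversionE e mulf_eq0 expf_eq0/= (negbTE cs0)/=.
case: ifPn => //= p0; rewrite /inv_pt e/=.
move: p0 {e}; rewrite gauge4E; case: p => x y u /= p0.
by congr (Some (HPt _ _ _)); field; rewrite ?p0 ?cs0.
Qed.

End conj_translation.

Section generators.
Context {R : realType}.
Implicit Types (g : R -> S3 R) (p q a h : hpt R) (G : S3 R -> S3 R).

Lemma dilationE lam : dilation lam = cmul lam (0 : R).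
Proof.
by apply/funext => -[q|]//=; congr (Some (HPt _ _ _)); ring.
Qed.

Lemma rotationE th : rotation th = cmul (cos th : R) (sin th).
Proof. by apply/funext => -[q|]//=; rewrite cos2Dsin2 mul1r. Qed.

Lemma mobius_generatorP G : mobius_generator G ->
  [\/ exists c s, c ^+ 2 + s ^+ 2 != 0 /\ G = cmul c s,
      exists a, G = ltranslation a | G = @inversion R].
Proof.
case=> [lam l0|a|th|].
- apply: Or31; exists lam, 0; rewrite dilationE; split=> //.
  by rewrite expr0n addr0 expf_neq0// gt_eqF.
- by apply: Or32; exists a.
- apply: Or31; exists (cos th), (sin th); rewrite rotationE; split=> //.
  by rewrite cos2Dsin2 oner_neq0.
- exact: Or33.
Qed.

Lemma sum_sqr_fourth_root (c s : R) : c ^+ 2 + s ^+ 2 != 0 ->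
  exists2 k, 0 < k & c ^+ 2 + s ^+ 2 = k ^+ 4.
Proof.
move=> cs0.
have n0 : 0 < c ^+ 2 + s ^+ 2 by rewrite lt_def cs0 addr_ge0 ?sqr_ge0.
exists (Num.sqrt (Num.sqrt (c ^+ 2 + s ^+ 2))); first by rewrite !sqrtr_gt0.
by rewrite -[4%N]/(2 * 2)%N exprM !sqr_sqrtr// ?ltW// sqrtr_gt0.
Qed.

Lemma kdist_cmul (c s k : R) p q : 0 < k -> c ^+ 2 + s ^+ 2 = k ^+ 4 ->
  kdist (HPt (c * hx p - s * hy p) (s * hx p + c * hy p) (k ^+ 4 * hu p))
    (HPt (c * hx q - s * hy q) (s * hx q + c * hy q) (k ^+ 4 * hu q)) =
  k * k * kdist p q.
Proof.
move=> k0 e; rewrite -expr2 -[k ^+ 2]ger0_norm ?sqr_ge0// -sqrtr_sqr.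
rewrite -[_ ^+ 2 ^+ 2]ger0_norm ?sqr_ge0// -sqrtr_sqr !kdistE !knormE.
rewrite -!sqrtrM ?sqrtr_ge0 ?sqr_ge0//; congr (Num.sqrt (Num.sqrt _)).
rewrite (_ : k ^+ 2 ^+ 2 ^+ 2 = (k ^+ 4) ^+ 2); last by rewrite -!exprM.
by rewrite -e !gauge4E/=; field.
Qed.

Lemma generator_conformal G : mobius_generator G -> exists rho : hpt R -> R,
  forall p p', G (Some p) = Some p' -> contact_at G p (rho p) /\
    forall q q', G (Some q) = Some q' ->
      kdist p' q' = rho p * rho q * kdist p q.
Proof.
move=> /mobius_generatorP[[c [s [cs0 ->]]]|[a ->]| ->].
- have [k k0 ke] := sum_sqr_fourth_root cs0.
  exists (fun=> k) => p p' /= [<-]; split; first exact: contact_cmul.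
  by move=> q q' [<-]; rewrite ke kdist_cmul.
- exists (fun=> 1) => p p' /= [<-]; split; first exact: contact_ltranslation.
  by move=> q q' [<-]; rewrite kdist_hmul !mul1r.
- exists (fun p => (knorm p)^-1) => p p'; rewrite inversionE.
  case: ifPn => // p0 [<-]; split; first exact: contact_inversion.
  by move=> q q'; rewrite inversionE; case: ifPn => // q0 [<-]; rewrite kdist_inv_pt.
Qed.

Lemma generator_inj G : mobius_generator G -> injective G.
Proof.
move=> /mobius_generatorP[[c [s [cs0 ->]]]|[a ->]| ->].
- apply: (@can_inj _ _ _ (cmul (c / (c ^+ 2 + s ^+ 2)) (- s / (c ^+ 2 + s ^+ 2)))).
  by move=> [[x y u]|]//=; congr (Some (HPt _ _ _)); field.
- apply: (@can_inj _ _ _ (ltranslation (hinv a))).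
  by move=> [[x y u]|]//=; rewrite /hmul/=; congr (Some (HPt _ _ _)); field.
- exact: (inv_inj (@inversionK R)).
Qed.

Lemma legendrian_near_Some g t0 : legendrian_near g t0 -> exists p, g t0 = Some p.
Proof.
move=> /legendrian_nearP[e [X [Y [U [e0 _ h]]]]].
by eexists; apply: h; rewrite subrr normr0.
Qed.

(** If only the inverted chart is given at a finite point, the inverted point is finite and nonzero,
    so the inversion is a contact map there and leads back to [g]. *)
Lemma knot_near_finite L g t0 p : legendrian_knot L g -> g t0 = Some p ->
  legendrian_near g t0.
Proof.
move=> [_ [_ [_ /(_ t0)[//|nI]]]] gp.
have [q] := legendrian_near_Some nI; rewrite /= gp inversionE.
case: ifPn => // p0 [qE].
have q0 : gauge4 (inv_pt p) != 0 by rewrite gauge4_inv ?invr_eq0.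
have Igp : (@inversion R \o g) t0 = Some (inv_pt p) by rewrite /= gp inversion_pt.
have [_ /(_ _ _ Igp nI)[]] := contact_inversion q0.
rewrite (_ : _ \o _ = g)//.
by apply/funext => t; rewrite /= inversionK.
Qed.

Lemma knot_near_infinite L g t0 : legendrian_knot L g -> g t0 = None ->
  legendrian_near (@inversion R \o g) t0.
Proof.
move=> [_ [_ [_ /(_ t0)[nI|//]]]] gp.
by have [q] := legendrian_near_Some nI; rewrite gp.
Qed.

(** Between finite points [G] is a contact map. At a parameter where [g] is infinite, the inverted
    chart of [G \o g] is the conjugate of [G] by the inversion, applied to a Legendrian curve
    through the origin. *)
Lemma knot_generator L g G : legendrian_knot L g -> mobius_generator G ->
  legendrian_knot L (G \o g).
Proof.
move=> gK GG; have [L0 [gL [gI _]]] := gK.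
split=> //; split; first by move=> t; rewrite /= gL.
split; first by move=> s t hs ht /(generator_inj GG); exact: gI.
move=> t0; case gt0 : (g t0) => [p|].
  have ng := knot_near_finite gK gt0.
  case Gp : (G (Some p)) => [q|].
    have [rho /(_ _ _ Gp)[[_ /(_ _ _ gt0 ng)[? _]] _]] := generator_conformal GG.
    by left.
  (* Only the inversion sends a finite point to infinity, and the inverted chart of the image is
     then [g] itself. *)
  right; move: Gp; move/mobius_generatorP : GG => [[c [s [cs0 ->]]]|[a ->]| ->]//.
  rewrite (_ : _ \o _ = g)//.
  by apply/funext => t; rewrite /= inversionK.
have nI := knot_near_infinite gK gt0.
have It0 : (@inversion R \o g) t0 = Some (HPt 0 0 0) by rewrite /= gt0.
move/mobius_generatorP : GG => [[c [s [cs0 ->]]]|[a ->]| ->]; last by left.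
- right.
  set c' := c / (c ^+ 2 + s ^+ 2); set s' := s / (c ^+ 2 + s ^+ 2).
  have cs' : c' ^+ 2 + s' ^+ 2 != 0.
    rewrite (_ : _ + _ = (c ^+ 2 + s ^+ 2)^-1) ?invr_eq0//.
    by rewrite /c' /s'; field.
  have [k k0 ke] := sum_sqr_fourth_root cs'.
  have [_ /(_ _ _ It0 nI)[]] := contact_cmul (HPt 0 0 0) k0 ke.
  rewrite (_ : _ \o _ = @inversion R \o (cmul c s \o g))//.
  by apply/funext => t; rewrite /= inversion_cmul.
(* The conjugation formula involves [i a], which is infinite for [a = 0]; that translation is the
   identity. *)
- right; have [/gauge4_eq0 a0|a0] := eqVneq (gauge4 a) 0.
    rewrite (_ : _ \o _ = @inversion R \o g)//.
    apply/funext => t; rewrite /= a0; congr inversion; case: (g t) => [q|]//=.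
    by rewrite /hmul/=; case: q => x y u /=; congr (Some (HPt _ _ _)); ring.
  rewrite (_ : _ \o _ = (ltranslation (inv_pt a) \o cmul (conj_re a) (conj_im a)
    \o @inversion R \o ltranslation (hinv (inv_pt (hinv a)))) \o
    (@inversion R \o g)); last first.
    by apply/funext => t; rewrite /= -inversion_ltranslation// inversionK.
  set m := hinv (inv_pt (hinv a)).
  have m0 : gauge4 m != 0.
    by rewrite !gauge4_hinv gauge4_inv ?invr_eq0// gauge4_hinv.
  have cs0 : conj_re a ^+ 2 + conj_im a ^+ 2 != 0.
    rewrite (_ : _ + _ = (gauge4 a)^-1) ?invr_eq0//.
    by move: a0; rewrite /conj_re /conj_im gauge4E => a0; field.
  have [k k0 ke] := sum_sqr_fourth_root cs0.
  have c1 := contact_ltranslation m (HPt 0 0 0).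
  have e1 : ltranslation m (Some (HPt 0 0 0)) = Some m by rewrite /= hmul0.
  have c2 := contact_at_comp e1 c1 (contact_inversion m0).
  have e2 : (@inversion R \o ltranslation m) (Some (HPt 0 0 0)) = Some (inv_pt m).
    rewrite -[LHS]/(inversion (ltranslation m (Some (HPt 0 0 0)))) e1.
    exact: inversion_pt.
  have c3 := contact_at_comp e2 c2 (contact_cmul (inv_pt m) k0 ke).
  have c4 := contact_at_comp _ c3 (contact_ltranslation (inv_pt a) _).
  have [_ /(_ _ _ It0 nI)[]//] := c4 _ (congr1 (cmul (conj_re a) (conj_im a)) e2).
Qed.

End generators.

(** * Second-order expansion of the distance along a curve *)

Section first_order.
Context {R : realType}.
Implicit Types (f : R -> R) (t l : R).

Lemma isdP f t0 l : is_derive t0 1 f l <->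
  forall eps, 0 < eps -> exists2 d, 0 < d & forall t, `|t - t0| < d ->
    `|f t - f t0 - l * (t - t0)| <= eps * `|t - t0|.
Proof.
split=> [[fd fl] eps eps0|h].
  have fc : (fun h => h^-1 *: (f (h *: 1 + t0) - f t0)) @ 0^' --> l.
    by rewrite -fl; exact: fd.
  have /cvgrPdist_le/(_ eps eps0) := fc.
  rewrite near_withinE => /nbhs_ballP[d /= d0 hd].
  exists d => // t td; have [->|tt0] := eqVneq t t0.
    by rewrite !subrr mulr0 subrr normr0 mulr0.
  have tt0' : t - t0 != 0 by rewrite subr_eq0.
  have := hd (t - t0); rewrite /ball/= sub0r normrN => /(_ td tt0').
  rewrite /GRing.scale/= mulr1 subrK => le.
  rewrite -[leLHS](@divfK _ `|t - t0|) ?normr_eq0//.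
  rewrite ler_wpM2r// -normf_div.
  by rewrite (_ : _ / _ = (t - t0)^-1 * (f t - f t0) - l) 1?distrC//; field.
have fc : (fun h => h^-1 *: (f (h *: 1 + t0) - f t0)) @ 0^' --> l.
  apply/cvgrPdist_le => eps eps0; rewrite near_withinE.
  have [d d0 hd] := h _ eps0; apply/nbhs_ballP; exists d => //= k.
  rewrite /ball/= sub0r normrN => kd k0.
  have := hd (k + t0); rewrite addrK => /(_ kd) le.
  rewrite /GRing.scale/= mulr1 distrC.
  rewrite (_ : _ - _ = (f (k + t0) - f t0 - l * k) / k); last by field.
  by rewrite normf_div ler_pdivrMr ?normr_gt0.
split; first by apply/cvg_ex; exists l.
exact: cvg_lim fc.
Qed.

Lemma mvt_ball f df t0 e t : (forall s, `|s - t0| < e -> is_derive s 1 f (df s)) ->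
  `|t - t0| < e -> exists2 c, `|c - t0| <= `|t - t0| & f t - f t0 = df c * (t - t0).
Proof.
move=> fd te.
have [tt0|/ltW tt0] := leP t t0.
  have [c cI fE] : exists2 c, c \in `[t, t0]%R & f t0 - f t = df c * (t0 - t).
    apply: MVT_segment tt0 _ _ => [s|].
      rewrite in_itv/= => /andP[ts st0]; apply: fd.
      rewrite ler0_norm ?subr_le0 ?ltW//.
      by move: te; rewrite ler0_norm ?subr_le0//; lra.
    apply: continuous_in_subspaceT => /= s; rewrite inE/= in_itv/= => /andP[ts st0].
    apply: isd_continuous (fd s _); rewrite ler0_norm ?subr_le0//.
    by move: te; rewrite ler0_norm ?subr_le0//; lra.
  exists c; move: cI; rewrite in_itv/= => /andP[tc ct0].
    by rewrite !ler0_norm ?subr_le0//; lra.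
  by rewrite -opprB fE; ring.
have [c cI fE] : exists2 c, c \in `[t0, t]%R & f t - f t0 = df c * (t - t0).
  apply: MVT_segment tt0 _ _ => [s|].
    rewrite in_itv/= => /andP[ts st0]; apply: fd.
    rewrite ger0_norm ?subr_ge0 ?ltW//.
    by move: te; rewrite ger0_norm ?subr_ge0//; lra.
  apply: continuous_in_subspaceT => /= s; rewrite inE/= in_itv/= => /andP[ts st0].
  apply: isd_continuous (fd s _); rewrite ger0_norm ?subr_ge0//.
  by move: te; rewrite ger0_norm ?subr_ge0//; lra.
exists c => //; move: cI; rewrite in_itv/= => /andP[tc ct0].
by rewrite !ger0_norm ?subr_ge0//; lra.
Qed.

Definition slope f t0 t : R :=
  if t == t0 then derive1 f t0 else (f t - f t0) / (t - t0).

(** Second-order Taylor expansion: the remainder [r] has derivative [o(s - t0)], so by the mean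
    value theorem [r] is [o((t - t0) ^ 2)]. *)
Lemma isd_slope f t0 e l : 0 < e ->
  (forall s, `|s - t0| < e -> derivable f s 1) ->
  is_derive t0 1 (derive1 f) l -> is_derive t0 1 (slope f t0) (l / 2).
Proof.
move=> e0 fd /isdP fd2; apply/isdP => eps eps0.
have [d d0 hd] := fd2 _ eps0.
exists (Num.min d e); first by rewrite lt_min d0.
move=> t; rewrite lt_min => /andP[td te].
rewrite /slope eqxx; case: eqVneq => [->|tt0].
  by rewrite !subrr mulr0 subrr normr0 mulr0.
have tt0' : t - t0 != 0 by rewrite subr_eq0.
pose r s := f s - (derive1 f t0 * (s - t0) + l / 2 * (s - t0) ^+ 2).
have dr s : `|s - t0| < e -> is_derive s 1 r
    (derive1 f s - derive1 f t0 - l * (s - t0)).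
  move=> se; have dst := isdB (is_derive_id s 1) (is_derive_cst t0 s 1).
  apply: is_derive_eq (isdB (isd_derive1 (fd _ se))
    (isdD (isdM (is_derive_cst (derive1 f t0) s 1) dst)
      (isdM (is_derive_cst (l / 2) s 1) (isdX2 dst)))) _.
  by rewrite /=; field.
have [c ct rE] := mvt_ball dr te.
have {}rE : f t - f t0 - derive1 f t0 * (t - t0) - l / 2 * (t - t0) ^+ 2 =
    (derive1 f c - derive1 f t0 - l * (c - t0)) * (t - t0).
  by rewrite -rE /r; ring.
rewrite (_ : _ - _ = (f t - f t0 - derive1 f t0 * (t - t0) -
  l / 2 * (t - t0) ^+ 2) / (t - t0)); last by field.
rewrite rE mulfK//; apply: le_trans (hd _ (le_lt_trans ct td)) _.
by rewrite ler_wpM2l// ltW.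
Qed.

Lemma isd_quadratic f t0 e C : 0 < e -> f t0 = 0 ->
  (forall t, `|t - t0| < e -> `|f t| <= C * `|t - t0| ^+ 2) ->
  is_derive t0 1 f 0.
Proof.
move=> e0 f0 h; apply/isdP => eps eps0.
have C0 : 0 < `|C| + 1 by rewrite ltr_wpDl.
exists (Num.min e (eps / (`|C| + 1))).
  by rewrite lt_min e0 divr_gt0.
move=> t; rewrite lt_min => /andP[te]; rewrite ltr_pdivlMr// => tC.
rewrite f0 subr0 mul0r subr0; apply: le_trans (h _ te) _.
rewrite expr2 mulrA ler_wpM2r//; apply: le_trans _ (ltW tC).
by rewrite mulrC ler_wpM2l//; have := ler_norm C; lra.
Qed.

Lemma isd_linear_bound f t0 l : is_derive t0 1 f l -> f t0 = 0 ->
  exists C d, [/\ 0 <= C, 0 < d & forall t, `|t - t0| < d -> `|f t| <= C * `|t - t0|].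
Proof.
move=> /isdP/(_ _ ltr01)[d d0 hd] f0; exists (`|l| + 1), d.
split=> [||t /hd]; rewrite ?addr_ge0//.
rewrite f0 subr0 mul1r => h.
rewrite -[f t](subrK (l * (t - t0))) (le_trans (ler_normD _ _))//.
by rewrite normrM mulrDl mul1r addrC lerD2l.
Qed.

End first_order.

Section local_expansion.
Context {R : realType}.
Implicit Types (X Y U : R -> R) (g : R -> S3 R) (p : hpt R).

(* Near [t0] one has [|z| ~ |t - t0|] and, by horizontality, [u = O((t - t0)^3)],
   so that the vertical coordinate does not contribute to second order. *)
Lemma knorm_expansion X Y U t0 e : 0 < e -> legendrian_curve X Y U t0 e ->
  X t0 = 0 -> Y t0 = 0 -> U t0 = 0 ->
  let v := Num.sqrt (derive1 X t0 ^+ 2 + derive1 Y t0 ^+ 2) in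
  exists b, is_derive t0 1 (fun t => if t == t0 then v else
    knorm (HPt (X t) (Y t) (U t)) / `|t - t0|) b.
Proof.
move=> e0 [hX hY hU h] X0 Y0 U0 v.
have t0e : `|t0 - t0| < e by rewrite subrr normr0.
have dX1 := isd_slope e0 (fun s se => hX 0%N s se)
  (smooth_on_isd (smooth_on_derive1 hX) t0e).
have dY1 := isd_slope e0 (fun s se => hY 0%N s se)
  (smooth_on_isd (smooth_on_derive1 hY) t0e).
set X1 := slope X t0 in dX1; set Y1 := slope Y t0 in dY1.
have XE t : X t = X1 t * (t - t0).
  rewrite /X1 /slope; case: eqVneq => [->|tt0]; first by rewrite X0 subrr mulr0.
  by rewrite X0 subr0 divfK// subr_eq0.
have YE t : Y t = Y1 t * (t - t0).
  rewrite /Y1 /slope; case: eqVneq => [->|tt0]; first by rewrite Y0 subrr mulr0.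
  by rewrite Y0 subr0 divfK// subr_eq0.
have X10 : X1 t0 = derive1 X t0 by rewrite /X1 /slope eqxx.
have Y10 : Y1 t0 = derive1 Y t0 by rewrite /Y1 /slope eqxx.
(* Horizontality reads [U' = (t - t0) * Q / 2]. Since [Q] vanishes at [t0], [U'] is quadratic and
   [U] cubic in [t - t0]. *)
pose Q t := X1 t * derive1 Y t - Y1 t * derive1 X t.
have dQ : is_derive t0 1 Q _ := isdB
  (isdM dX1 (smooth_on_isd (smooth_on_derive1 hY) t0e))
  (isdM dY1 (smooth_on_isd (smooth_on_derive1 hX) t0e)).
have Q0 : Q t0 = 0 by rewrite /Q X10 Y10; ring.
have [C [d [C0 d0 hd]]] := isd_linear_bound dQ Q0.
have Ubound t : `|t - t0| < Num.min d e -> `|U t| <= C * `|t - t0| ^+ 3.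
  rewrite lt_min => /andP[td te].
  have [c ct UE] := mvt_ball (fun s se => smooth_on_isd hU se) te.
  rewrite -[U t]subr0 -U0 UE normrM exprSr mulrA ler_wpM2r//.
  have ce := le_lt_trans ct te; have cd := le_lt_trans ct td.
  have [_ ->] := h _ ce.
  rewrite (_ : _ / 2 = (c - t0) * Q c / 2); last first.
    by rewrite /Q {1}XE {1}YE; ring.
  rewrite !normrM [`|2^-1|]gtr0_norm ?invr_gt0//.
  apply: (@le_trans _ _ (`|c - t0| * `|Q c|)).
    by rewrite ler_piMr ?mulr_ge0//; lra.
  apply: (@le_trans _ _ (`|c - t0| * (C * `|c - t0|))).
    by rewrite ler_wpM2l// hd.
  rewrite mulrCA ler_wpM2l// expr2 ler_pM//.
(* The vertical part of [gauge4] divided by [(t - t0) ^ 4]; it is quadratic in [t - t0], so its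
   derivative vanishes. *)
pose W t := if t == t0 then 0 else (4 * (U t / (t - t0) ^+ 2)) ^+ 2.
have dW : is_derive t0 1 W 0.
  apply: (@isd_quadratic _ _ _ (Num.min d e) (16 * C ^+ 2)).
  - by rewrite lt_min d0.
  - by rewrite /W eqxx.
  move=> t td; rewrite /W; case: eqVneq => [->|tt0].
    by rewrite subrr normr0 expr0n mulr0.
  have tt0' : 0 < `|t - t0| by rewrite normr_gt0 subr_eq0.
  rewrite normrX normrM normf_div normrX [`|4|]ger0_norm//.
  rewrite (_ : 16 * C ^+ 2 * `|t - t0| ^+ 2 = (4 * (C * `|t - t0|)) ^+ 2); last by ring.
  rewrite ler_sqr ?nnegrE ?mulr_ge0// ler_wpM2l// ler_pdivrMr ?exprn_gt0//.
  by rewrite -mulrA -exprS Ubound.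
(* The norm is [|t - t0|] times the fourth root of [G], which is differentiable because [G] is
   positive at [t0]. *)
pose G t := (X1 t ^+ 2 + Y1 t ^+ 2) ^+ 2 + W t.
have dG : is_derive t0 1 G _ := isdD (isdX2 (isdD (isdX2 dX1) (isdX2 dY1))) dW.
have v2 : 0 < X1 t0 ^+ 2 + Y1 t0 ^+ 2.
  have [/sum_sqr_neq0 n0 _] := h _ t0e.
  by rewrite X10 Y10 lt_def n0 addr_ge0 ?sqr_ge0.
have G0 : G t0 = (X1 t0 ^+ 2 + Y1 t0 ^+ 2) ^+ 2 by rewrite /G /W eqxx addr0.
have Gp : 0 < G t0 by rewrite G0 exprn_gt0.
have sGp : 0 < Num.sqrt (G t0) by rewrite sqrtr_gt0.
have dH := @isd_sqrt R (fun t => Num.sqrt (G t)) t0 _ sGp (isd_sqrt Gp dG).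
eexists; apply: isd_near dH; apply: (@filterE _ (nbhs t0)) => t; case: eqVneq => [->|tt0].
  by rewrite G0 sqrtr_sqr ger0_norm ?ltW// X10 Y10.
have tt0' : t - t0 != 0 by rewrite subr_eq0.
rewrite knormE.
have -> : gauge4 (HPt (X t) (Y t) (U t)) = (t - t0) ^+ 2 ^+ 2 * G t.
  rewrite gauge4E/= XE YE /G /W (negbTE tt0); by field.
by rewrite sqrtrM ?sqr_ge0// sqrtr_sqr ger0_norm ?sqr_ge0//
  sqrtrM ?sqr_ge0// sqrtr_sqr mulrAC divff ?mul1r// normr_eq0.
Qed.

End local_expansion.

(** * Regularisation by balls and by parameter intervals *)

Section finite_part.
Context {R : realType}.
Local Notation mu := (@lebesgue_measure R).

(** An annulus [Y + a <= y <= Y + a'] has length [1 / (Y + a) - 1 / (Y + a')] in the parameter.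
    Against a density close to [c * y ^ 2] its mass tends to [c * (a' - a)], as [(Y + a') / (Y + a)]
    tends to 1. *)
Lemma annulus_arith (c a a' e : R) : 0 < c -> 0 < e -> a <= a' ->
  exists2 eta, 0 < eta <= c & exists Y0, forall Y, Y0 <= Y -> 0 < Y + a /\
    forall I, (c - eta) * (Y + a) ^+ 2 * ((Y + a)^-1 - (Y + a')^-1) <= I ->
      I <= (c + eta) * (Y + a') ^+ 2 * ((Y + a)^-1 - (Y + a')^-1) ->
      `|I - (a' - a) * c| <= e.
Proof.
move=> c0 e0 aa'.
have D0 : 0 <= a' - a by rewrite subr_ge0.
have K0 : 0 < (a' - a + 1) * (c + 2) by rewrite mulr_gt0//; lra.
(* For [eta <= 1], [(c + eta) * (1 + eta) <= c + eta * (c + 2)]; the summand 1 keeps the denominator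
   positive when [a = a']. *)
pose eta := Num.min (Num.min 1 c) (e / ((a' - a + 1) * (c + 2))).
have eta0 : 0 < eta by rewrite !lt_min ltr01 c0 divr_gt0.
have [eta1 etac etae] : [/\ eta <= 1, eta <= c & eta * ((a' - a + 1) * (c + 2)) <= e].
  by split; rewrite -?ler_pdivlMr// /eta !ge_min ?lexx ?orbT.
exists eta; [by rewrite eta0|exists ((a' - a) / eta + 1 - a) => Y hY].
have q0 : 0 < Y + a.
  have : 0 <= (a' - a) / eta by rewrite divr_ge0// ltW.
  by lra.
split=> // I.
have q'0 : 0 < Y + a' by lra.
set p := Y + a in q0 *; set p' := Y + a' in q'0 *.
have pp' : p <= p' by rewrite /p /p'; lra.
have eD : a' - a <= eta * p.
  by rewrite mulrC -ler_pdivrMr// /p; lra.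
have dE : a' - a = p' - p by rewrite /p /p'; ring.
have -> : (c - eta) * p ^+ 2 * (p^-1 - p'^-1) = (a' - a) * (c - eta) * (p / p').
  by rewrite dE; field; rewrite !gt_eqF.
have -> : (c + eta) * p' ^+ 2 * (p^-1 - p'^-1) = (a' - a) * (c + eta) * (p' / p).
  by rewrite dE; field; rewrite !gt_eqF.
have h1 : p' / p <= 1 + eta by rewrite ler_pdivrMr//; lra.
have h2 : 1 - eta <= p / p'.
  rewrite ler_pdivlMr//.
  have : eta * p <= eta * p' by rewrite ler_wpM2l// ltW.
  by lra.
move=> l1 l2.
have {l1}l1 : (a' - a) * (c - eta) * (1 - eta) <= I.
  by apply: le_trans l1; rewrite ler_wpM2l// mulr_ge0// subr_ge0.
have {l2}l2 : I <= (a' - a) * (c + eta) * (1 + eta).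
  by apply: le_trans l2 _; rewrite ler_wpM2l// mulr_ge0//; lra.
have B : (a' - a) * (eta * (c + 2)) <= e.
  apply: le_trans etae; rewrite [leLHS]mulrCA ler_wpM2l ?(ltW eta0)//.
  by rewrite ler_wpM2r//; lra.
have e1 : (a' - a) * (c + eta) * (1 + eta) <= (a' - a) * c + (a' - a) * (eta * (c + 2)).
  rewrite -mulrDr -mulrA ler_wpM2l//.
  have : eta * eta <= eta * 1 by rewrite ler_wpM2l// ltW.
  by nra.
have e2 : (a' - a) * c - (a' - a) * (eta * (c + 2)) <= (a' - a) * (c - eta) * (1 - eta).
  rewrite -mulrBr -mulrA ler_wpM2l//.
  have : 0 <= eta * eta by rewrite mulr_ge0// ltW.
  have := ltW eta0; by nra.
by rewrite ler_norml; lra.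
Qed.

Lemma Rintegral_bounds (D : set (measurableTypeR R)) (f : R -> R) (m M w : R) :
  measurable D -> mu D = w%:E -> mu.-integrable D (EFin \o f) ->
  (forall t, D t -> m <= f t <= M) ->
  m * w <= Rintegral mu D f <= M * w.
Proof.
move=> mD Dw fi fmM.
have cI (k : R) : mu.-integrable D (EFin \o cst k).
  apply: measurable_bounded_integrable.
  - exact: mD.
  - by rewrite [ltLHS]Dw ltry.
  - exact: measurable_cst.
  - exact: bounded_cst.
have cE (k : R) : k * w = Rintegral mu D (cst k).
  by rewrite (Rintegral_cst mu mD) [X in fine X]Dw.
apply/andP; split; rewrite cE.
  by apply: (le_Rintegral mD (cI m) fi) => t /fmM/andP[].
by apply: (le_Rintegral mD fi (cI M)) => t /fmM/andP[].
Qed.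

End finite_part.

(** * Integrals of a function with a double pole, off intervals around the pole *)

Section finite_part.
Context {R : realType}.
Local Notation mu := (@lebesgue_measure R).
Local Notation measurableR D := (@measurable _ (measurableTypeR R) D).

Variables (L t0 v : R) (f : R -> R).
Hypotheses (t0_gt0 : 0 < t0) (t0_ltL : t0 < L) (v_gt0 : 0 < v).
Hypothesis f_ge0 : forall t, 0 <= f t.
Hypothesis mf : measurable_fun (`[0, L[%classic : set (measurableTypeR R)) f.
Hypothesis f_bounded : forall eta : R, 0 < eta -> exists M : R, forall t : R,
  0 <= t < L -> eta <= `|t - t0| -> f t <= M.
Hypothesis f_pole : forall eps : R, 0 < eps -> exists2 d : R, 0 < d & forall t : R,
  t != t0 -> `|t - t0| < d -> `|f t * (t - t0) ^+ 2 - v^-1| <= eps.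

(** The ends of the removed interval are given by their values of [y = 1 / |t - t0|], on the left
    and on the right of [t0]. *)
Definition outside (y1 y2 : R) : set R :=
  `[0, t0 - y1^-1]%classic `|` `[t0 + y2^-1, L[%classic.

Let measurable_outside y1 y2 : measurableR (outside y1 y2).
Proof. exact: measurableU. Qed.

Lemma outside_sub (y1 y2 : R) : 0 < y1 -> 0 < y2 -> outside y1 y2 `<=` `[0, L[%classic.
Proof.
have t0p := t0_gt0; have t0L := t0_ltL.
move=> y10 y20 t.
have i1 : 0 < y1^-1 by rewrite invr_gt0.
have i2 : 0 < y2^-1 by rewrite invr_gt0.
by rewrite /outside/= !in_itv/= => -[] /andP[h1 h2]; apply/andP; split; lra.
Qed.

Lemma integrable_outside (D : set R) (eta : R) : 0 < eta -> measurableR D ->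
  D `<=` [set t : R | 0 <= t < L /\ eta <= `|t - t0|] ->
  mu.-integrable D (EFin \o f).
Proof.
move=> eta0 mD sD; have D0L : D `<=` `[0, L[%classic.
  by move=> t /sD[/= h _]; rewrite /= in_itv.
apply: measurable_bounded_integrable; first exact: mD.
- apply: (@le_lt_trans _ _ (mu `[0, L[%classic)).
    by apply: le_measure; rewrite ?inE.
  by rewrite lebesgue_measure_itv/=; case: ifPn => // _; rewrite -EFinB ltry.
- by apply: measurable_funS mf; first exact: measurable_itv.
have [M hM] := f_bounded eta0.
exists M; split; first exact: num_real.
move=> x Mx t /= /sD[/= tL te]; rewrite ger0_norm//.
by apply: le_trans (ltW Mx); exact: hM.
Qed.

Lemma outside_away (y1 y2 : R) : 0 < y1 -> 0 < y2 -> outside y1 y2 `<=`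
  [set t : R | 0 <= t < L /\ Num.min y1^-1 y2^-1 <= `|t - t0|].
Proof.
have t0p := t0_gt0; have t0L := t0_ltL.
move=> y10 y20 t to; have /= := outside_sub y10 y20 to; rewrite in_itv/= => tL.
split=> //; move: to; rewrite /outside/= !in_itv/= => -[] /andP[h1 h2].
- have i1 : 0 < y1^-1 by rewrite invr_gt0.
  by rewrite ge_min; apply/orP; left; rewrite ler0_norm; lra.
- have i2 : 0 < y2^-1 by rewrite invr_gt0.
  by rewrite ge_min; apply/orP; right; rewrite ger0_norm; lra.

Qed.

Let integrable_out (y1 y2 : R) : 0 < y1 -> 0 < y2 ->
  mu.-integrable (outside y1 y2) (EFin \o f).
Proof.
move=> y10 y20; apply: (@integrable_outside _ (Num.min y1^-1 y2^-1)).
- by rewrite lt_min !invr_gt0 y10.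
- exact: measurable_outside.
- exact: outside_away.
Qed.

Definition outside_integral (y1 y2 : R) := Rintegral mu (outside y1 y2) f.

(** On [D] the factor [f t * (t - t0) ^ 2] is within [eta] of [1 / v], while [1 / (t - t0) ^ 2] lies
    between [y ^ 2] and [y' ^ 2]. *)
Lemma annulus_estimate (D : set R) (eta d y y' : R) : measurableR D ->
  0 < y -> y <= y' -> y^-1 < d ->
  (forall t : R, t != t0 -> `|t - t0| < d -> `|f t * (t - t0) ^+ 2 - v^-1| <= eta) ->
  eta <= v^-1 ->
  D `<=` [set t : R | 0 <= t < L /\ y'^-1 <= `|t - t0| <= y^-1] ->
  mu D = (y^-1 - y'^-1)%:E ->
  (v^-1 - eta) * y ^+ 2 * (y^-1 - y'^-1) <= Rintegral mu D f <=
  (v^-1 + eta) * y' ^+ 2 * (y^-1 - y'^-1).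
Proof.
have t0p := t0_gt0; have t0L := t0_ltL.
move=> mD y0 yy' yd hd etav sD Dw; have y'0 : 0 < y' by exact: lt_le_trans yy'.
apply: Rintegral_bounds => //.
  apply: (@integrable_outside _ (y'^-1)) => //; first by rewrite invr_gt0.
  by move=> t /sD[/= h /andP[]].
move=> t /sD[/= tL /andP[h1 h2]].
have tt0 : 0 < `|t - t0| by apply: lt_le_trans h1; rewrite invr_gt0.
have := hd t; rewrite -subr_eq0 -normr_gt0 => /(_ tt0 (le_lt_trans h2 yd)).
rewrite -[(t - t0) ^+ 2]ger0_norm ?sqr_ge0// normrX; set s := `|t - t0| in tt0 h1 h2 *.
have s20 : 0 < s ^+ 2 by rewrite exprn_gt0.
rewrite ler_norml => /andP[l1 l2]; apply/andP; split.
- apply: (@le_trans _ _ ((v^-1 - eta) / s ^+ 2)); last by rewrite ler_pdivrMr//; lra.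
  rewrite ler_wpM2l ?subr_ge0// -exprVn ler_pXn2r ?nnegrE ?invr_ge0 ?(ltW y0) ?(ltW tt0)//.
  move: h2; rewrite -[y^-1]div1r -[s^-1]div1r !ler_pdivlMr//.
  by rewrite mulrC.
- apply: (@le_trans _ _ ((v^-1 + eta) / s ^+ 2)); first by rewrite ler_pdivlMr//; lra.
  have ve : 0 <= v^-1 + eta.
    have : 0 <= f t * s ^+ 2 by rewrite mulr_ge0// ltW.
    by lra.
  rewrite ler_wpM2l// -exprVn ler_pXn2r ?nnegrE ?invr_ge0 ?(ltW y'0) ?(ltW tt0)//.
  move: h1; rewrite -[y'^-1]div1r -[s^-1]div1r !ler_pdivrMr//.
  by rewrite mulrC.
Qed.

Lemma J_setU (y1 y2 y1' y2' : R) (D : set R) : measurableR D -> 0 < y1' -> 0 < y2' ->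
  outside y1' y2' = outside y1 y2 `|` D -> [disjoint outside y1 y2 & D] ->
  outside_integral y1' y2' = outside_integral y1 y2 + Rintegral mu D f.
Proof.
move=> mD y1'0 y2'0 E dis; rewrite /outside_integral E Rintegral_setU//.
by rewrite -E; exact: integrable_out.
Qed.

(* Both one-sided statements say that [f dt] is asymptotic to [v^-1 dy] in the
   coordinate [y = 1 / |t - t0|]. *)
Lemma J_right_le (a a' e : R) : 0 < e -> a <= a' -> exists Y0 : R, forall Y y1 : R, Y0 <= Y ->
  0 < y1 -> 0 < Y + a /\
  `|outside_integral y1 (Y + a') - outside_integral y1 (Y + a) - (a' - a) / v| <= e.
Proof.
have t0p := t0_gt0; have t0L := t0_ltL.
move=> e0 aa'; have v0 : 0 < v^-1 by rewrite invr_gt0.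
have [eta /andP[eta0 etav] [Y0 hY0]] := annulus_arith v0 e0 aa'.
have [d d0 hd] := f_pole eta0.
have m0 : 0 < Num.min d (L - t0) by rewrite lt_min d0 subr_gt0.
(* The second bound keeps the annulus within the period and within the range of the pole
   estimate. *)
exists (Num.max Y0 ((Num.min d (L - t0))^-1 + 1 - a)) => Y y1.
rewrite ge_max => /andP[/hY0[q0 hI] hY] y10; split=> //.
have q'0 : 0 < Y + a' by lra.
have qm : (Y + a)^-1 < Num.min d (L - t0).
  by rewrite invf_plt ?posrE//; lra.
move: (qm); rewrite lt_min => /andP[qd qL].
have qq : Y + a <= Y + a' by lra.
have iqq : (Y + a')^-1 <= (Y + a)^-1 by rewrite lef_pV2 ?posrE.
have iq0 : 0 < (Y + a')^-1 by rewrite invr_gt0.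
have iy0 : 0 < y1^-1 by rewrite invr_gt0.
pose D : set R := `[t0 + (Y + a')^-1, t0 + (Y + a)^-1[%classic.
have mD : measurableR D by exact: measurable_itv.
have DE : outside_integral y1 (Y + a') = outside_integral y1 (Y + a) + Rintegral mu D f.
  clear hI hd hY hY0 d0 e0 eta0 etav m0 qm v0 qq.
  apply: J_setU => //.
  - rewrite /outside -setUA; congr setU; rewrite /D setUC.
    apply/seteqP; split=> t /=; rewrite !in_itv/=.
      move=> /andP[h1 h2]; have [h|h] := ltP t (t0 + (Y + a)^-1).
        by left; rewrite h1.
      by right.
    by case=> /andP[h1 h2]; apply/andP; split; lra.
  - apply/disj_setPS => t [[]]; rewrite /D/= !in_itv/= => /andP[h1 h2] /andP[h3 h4];
    by lra.
have -> : outside_integral y1 (Y + a') - outside_integral y1 (Y + a) = Rintegral mu D f.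
  by rewrite DE addrC addKr.
have Dw : mu D = ((Y + a)^-1 - (Y + a')^-1)%:E.
  rewrite /D lebesgue_measure_itv/= lte_fin ltrD2l -EFinB.
  case: ltP => [_|h]; first by congr EFin; ring.
  by congr EFin; lra.
have sD : D `<=` [set t : R | 0 <= t < L /\ (Y + a')^-1 <= `|t - t0| <= (Y + a)^-1].
  clear hI hd hY hY0 d0 e0 eta0 etav m0 qm v0 qq DE Dw q0 q'0.
  move=> t; rewrite /D/= in_itv/= => /andP[h1 h2]; split; first by apply/andP; split; lra.
  by rewrite ger0_norm; [apply/andP; split|]; lra.
by have /andP[] := annulus_estimate mD q0 qq qd hd etav sD Dw; exact: hI.
Qed.

Lemma J_left_le (a a' e : R) : 0 < e -> a <= a' -> exists Y0 : R, forall Y y2 : R, Y0 <= Y ->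
  0 < y2 -> 0 < Y + a /\
  `|outside_integral (Y + a') y2 - outside_integral (Y + a) y2 - (a' - a) / v| <= e.
Proof.
have t0p := t0_gt0; have t0L := t0_ltL.
move=> e0 aa'; have v0 : 0 < v^-1 by rewrite invr_gt0.
have [eta /andP[eta0 etav] [Y0 hY0]] := annulus_arith v0 e0 aa'.
have [d d0 hd] := f_pole eta0.
have m0 : 0 < Num.min d t0 by rewrite lt_min d0.
exists (Num.max Y0 ((Num.min d t0)^-1 + 1 - a)) => Y y2.
rewrite ge_max => /andP[/hY0[q0 hI] hY] y20; split=> //.
have q'0 : 0 < Y + a' by lra.
have qm : (Y + a)^-1 < Num.min d t0.
  by rewrite invf_plt ?posrE//; lra.
move: (qm); rewrite lt_min => /andP[qd qL].
have qq : Y + a <= Y + a' by lra.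
have iqq : (Y + a')^-1 <= (Y + a)^-1 by rewrite lef_pV2 ?posrE.
have iq0 : 0 < (Y + a')^-1 by rewrite invr_gt0.
have iy0 : 0 < y2^-1 by rewrite invr_gt0.
pose D : set R := `]t0 - (Y + a)^-1, t0 - (Y + a')^-1]%classic.
have mD : measurableR D by exact: measurable_itv.
have DE : outside_integral (Y + a') y2 = outside_integral (Y + a) y2 + Rintegral mu D f.
  clear hI hd hY hY0 d0 e0 eta0 etav m0 qm v0 qq.
  apply: J_setU => //.
  - rewrite /outside setUAC; congr setU; rewrite /D.
    apply/seteqP; split=> t /=; rewrite !in_itv/=.
      move=> /andP[h1 h2]; have [h|h] := leP t (t0 - (Y + a)^-1).
        by left; rewrite h1.
      by right.
    by case=> /andP[h1 h2]; apply/andP; split; lra.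
  - apply/disj_setPS => t [[]]; rewrite /D/= !in_itv/= => /andP[h1 h2] /andP[h3 h4];
    by lra.
have -> : outside_integral (Y + a') y2 - outside_integral (Y + a) y2 = Rintegral mu D f.
  by rewrite DE addrC addKr.
have Dw : mu D = ((Y + a)^-1 - (Y + a')^-1)%:E.
  rewrite /D lebesgue_measure_itv/= lte_fin ltrD2l ltrN2 -EFinB.
  case: ltP => [_|h]; first by congr EFin; ring.
  by congr EFin; lra.
have sD : D `<=` [set t : R | 0 <= t < L /\ (Y + a')^-1 <= `|t - t0| <= (Y + a)^-1].
  clear hI hd hY hY0 d0 e0 eta0 etav m0 qm v0 qq DE Dw q0 q'0.
  move=> t; rewrite /D/= in_itv/= => /andP[h1 h2]; split; first by apply/andP; split; lra.
  by rewrite ler0_norm; [apply/andP; split|]; lra.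
by have /andP[] := annulus_estimate mD q0 qq qd hd etav sD Dw; exact: hI.
Qed.

Lemma J_right (a a' e : R) : 0 < e -> exists Y0 : R, forall Y y1 : R, Y0 <= Y ->
  0 < y1 -> 0 < Y + a /\
  `|outside_integral y1 (Y + a') - outside_integral y1 (Y + a) - (a' - a) / v| <= e.
Proof.
have t0p := t0_gt0; have t0L := t0_ltL.
move=> e0; have [/(J_right_le e0)//|/ltW aa'] := leP a a'.
have [Y0 h] := J_right_le e0 aa'; exists Y0 => Y y1 hY y10.
have [q0] := h Y y1 hY y10; rewrite -normrN => hJ; split; first by lra.
by rewrite (_ : _ - _ - _ =
  - (outside_integral y1 (Y + a) - outside_integral y1 (Y + a') - (a - a') / v))//; ring.
Qed.

Lemma J_left (a a' e : R) : 0 < e -> exists Y0 : R, forall Y y2 : R, Y0 <= Y ->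
  0 < y2 -> 0 < Y + a /\
  `|outside_integral (Y + a') y2 - outside_integral (Y + a) y2 - (a' - a) / v| <= e.
Proof.
have t0p := t0_gt0; have t0L := t0_ltL.
move=> e0; have [/(J_left_le e0)//|/ltW aa'] := leP a a'.
have [Y0 h] := J_left_le e0 aa'; exists Y0 => Y y2 hY y20.
have [q0] := h Y y2 hY y20; rewrite -normrN => hJ; split; first by lra.
by rewrite (_ : _ - _ - _ =
  - (outside_integral (Y + a) y2 - outside_integral (Y + a') y2 - (a - a') / v))//; ring.
Qed.

(** Each one-sided estimate is uniform in the opposite end, so the ends can be shifted in turn; only
    [a1 + a2] matters in the limit. *)
Lemma J_both (a1 a2 e : R) : 0 < e -> exists Y0 : R, forall Y : R, Y0 <= Y ->
  [/\ 0 < Y + a1, 0 < Y + a2 &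
  `|outside_integral (Y + a1) (Y + a2) - outside_integral Y Y - (a1 + a2) / v| <= e].
Proof.
have t0p := t0_gt0; have t0L := t0_ltL.
move=> e0; have e20 : 0 < e / 2 by rewrite divr_gt0.
have [Y1 h1] := J_right 0 a2 e20; have [Y2 h2] := J_left 0 a1 e20.
exists (Num.max (Num.max Y1 Y2) (`|a1| + `|a2| + 1)) => Y.
rewrite !ge_max => /andP[/andP[hY1 hY2] hY].
have la1 : - a1 <= `|a1| by rewrite -normrN ler_norm.
have la2 : - a2 <= `|a2| by rewrite -normrN ler_norm.
have n1 := normr_ge0 a1; have n2 := normr_ge0 a2.
have p1 : 0 < Y + a1 by lra.
have p2 : 0 < Y + a2 by lra.
have p0 : 0 < Y by lra.
split=> //.
have [_] := h1 Y (Y + a1) hY1 p1; have [_] := h2 Y Y hY2 p0.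
rewrite !addr0 !subr0 !ler_norml => /andP[l1 l2] /andP[l3 l4].
rewrite mulrDl; clear hY1 hY2 hY p0 p1 p2 la1 la2 n1 n2 e0 e20.
by apply/andP; split; lra.
Qed.

End finite_part.

(** * Comparison of superlevel sets of the distance with parameter intervals *)

Section asymptotics.
Context {R : realType}.
Local Notation mu := (@lebesgue_measure R).
Local Notation measurableR D := (@measurable _ (measurableTypeR R) D).

Lemma le_Rintegral_set (A B : set R) (f : R -> R) :
  measurableR A -> measurableR B -> A `<=` B -> (forall t, 0 <= f t) ->
  mu.-integrable B (EFin \o f) -> Rintegral mu A f <= Rintegral mu B f.
Proof.
move=> mA mB AB f0 fi.
have mD : measurableR (B `\` A) by exact: measurableD.
rewrite -(setDUK AB) Rintegral_setU//.
- by rewrite lerDl; apply: Rintegral_ge0.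
- by rewrite setDUK.
- by apply/disj_setPS => t [? []].
Qed.

(* Since [1 / N = 1 / (v |t - t0|) - (b / v ^ 2) sgn (t - t0) + o(1)], in the
   coordinate [y = 1 / |t - t0|] the set [N >= eps] is, up to [o(1)], the set
   [y <= v / eps + b / v] on the right of [t0] and [y <= v / eps - b / v] on its
   left, and the two shifts cancel. *)
Lemma superlevel_asymptotics (L t0 v b : R) (f N : R -> R) :
  0 < t0 -> t0 < L -> 0 < v ->
  (forall t, 0 <= f t) ->
  measurable_fun (`[0, L[%classic : set (measurableTypeR R)) f ->
  (forall eta : R, 0 < eta -> exists M : R, forall t : R,
    0 <= t < L -> eta <= `|t - t0| -> f t <= M) ->
  (forall eps : R, 0 < eps -> exists2 d : R, 0 < d & forall t : R,
    t != t0 -> `|t - t0| < d -> `|f t * (t - t0) ^+ 2 - v^-1| <= eps) ->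
  measurable_fun (`[0, L[%classic : set (measurableTypeR R)) N ->
  (forall eta : R, 0 < eta -> exists2 m : R, 0 < m & forall t : R,
    0 <= t < L -> eta <= `|t - t0| -> m <= N t) ->
  N t0 = 0 -> (forall t, t != t0 -> 0 <= t < L -> 0 < N t) ->
  is_derive t0 1 (fun t => if t == t0 then v else N t / `|t - t0|) b ->
  forall e : R, 0 < e -> exists2 d : R, 0 < d & forall eps : R, 0 < eps < d ->
    `|Rintegral mu [set t | 0 <= t < L /\ eps <= N t] f -
      outside_integral L t0 f (v / eps) (v / eps)| <= e.
Proof.
move=> t00 t0L v0 f0 mf fb fp mN Nb N0 N1 dH e e0.
(* The margin [k] absorbs the [o(1)] at each end; two margins change the integral by
   [2 * k / v <= e / 2] in the limit. *)
pose k := Num.min (e * v / 4) 1.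
have ev : 0 < e * v / 4 by rewrite divr_gt0// mulr_gt0.
have k0 : 0 < k by rewrite lt_min ev ltr01.
have ke : k <= e * v / 4 by rewrite /k ge_min lexx.
have e20 : 0 < e / 2 by rewrite divr_gt0.
have [Y1 hY1] := J_both t00 t0L v0 f0 mf fb fp (- (b / v) + k) (b / v + k) e20.
have [Y2 hY2] := J_both t00 t0L v0 f0 mf fb fp (- (b / v) - k) (b / v - k) e20.
pose H t := if t == t0 then v else N t / `|t - t0|.
have H0 : H t0 = v by rewrite /H eqxx.
have Hn0 : H t0 != 0 by rewrite H0 gt_eqF.
have kv0 : 0 < k / v by rewrite divr_gt0.
(* First-order expansion of [1 / H]; multiplied by [v / |t - t0|] it expands [v / N] with error at
   most [k]. *)
have [d d0 hd] := (isdP _ _ _).1 (isdV Hn0 dH) _ kv0.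
have {}hd t : t != t0 -> 0 <= t < L -> `|t - t0| < d ->
    `|v / N t - (`|t - t0|^-1 - (b / v) * ((t - t0) / `|t - t0|))| <= k.
  move=> tt0 tL td; have s0 : 0 < `|t - t0| by rewrite normr_gt0 subr_eq0.
  have Nt := N1 _ tt0 tL.
  have := hd _ td; rewrite H0 /H (negbTE tt0) => h.
  rewrite (_ : _ - _ = ((N t / `|t - t0|)^-1 - v^-1 - (- b / v ^+ 2) * (t - t0)) *
    (v / `|t - t0|)); last by field; rewrite !gt_eqF.
  rewrite normrM [`|v / _|]gtr0_norm ?divr_gt0// mulrA ler_pdivrMr//.
  by rewrite -ler_pdivlMr// [leRHS]mulrAC.
have [m m0 hm] := Nb _ d0.
(* The last bound makes the widened ends lie within [d] of [t0], where the expansion of [v / N] is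
   available. *)
pose Y0 := Num.max (Num.max Y1 Y2) (d^-1 + `|b / v| + 2).
have Y0p : 0 < Y0.
  have : 0 < d^-1 by rewrite invr_gt0.
  have := normr_ge0 (b / v); move=> h1 h2.
  have : d^-1 + `|b / v| + 2 <= Y0 by rewrite /Y0 le_max lexx orbT.
  by lra.
exists (Num.min m (v / Y0)); first by rewrite lt_min m0 divr_gt0.
move=> eps /andP[eps0]; rewrite lt_min => /andP[em eY].
set Y := v / eps.
have YY : Y0 <= Y by rewrite /Y ler_pdivlMr// mulrC -ler_pdivlMr// ltW.
have := YY; rewrite {1}/Y0 !ge_max => /andP[/andP[Y1Y Y2Y] YB].
have [p1 p2 _] := hY1 _ Y1Y; have [q1 q2 _] := hY2 _ Y2Y.
have id0 : 0 < d^-1 by rewrite invr_gt0.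
have bn := ler_norm (b / v); have bn' : - (b / v) <= `|b / v|.
  by rewrite -normrN ler_norm.
have k1 : k <= 1 by rewrite /k ge_min lexx orbT.
set S := [set t | _].
have SE : S = `[0, L[%classic `&` N @^-1` `[eps, +oo[%classic.
  by apply/seteqP; split=> t /=; rewrite !in_itv/= ?andbT.
have mS : measurableR S.
  by rewrite SE; apply: mN; exact: measurable_itv.
have mO y1 y2 : measurableR (outside L t0 y1 y2) by exact: measurableU.
have iO y1 y2 : 0 < y1 -> 0 < y2 -> mu.-integrable (outside L t0 y1 y2) (EFin \o f).
  move=> y10 y20; apply: (@integrable_outside _ _ _ _ f0 mf fb _ (Num.min y1^-1 y2^-1)).
  - by rewrite lt_min !invr_gt0 y10.
  - exact: mO.
  - by apply: outside_away.
have yv t : t != t0 -> 0 <= t < L -> (eps <= N t) = (v / N t <= Y).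
  move=> tt0 tL; have Nt := N1 _ tt0 tL.
  by rewrite /Y ler_pdivrMr// mulrAC ler_pdivlMr// ler_pM2l.
have out1 : outside L t0 (Y + (- (b / v) - k)) (Y + (b / v - k)) `<=` S.
  move=> t tO; have /= := outside_sub t00 t0L q1 q2 tO; rewrite in_itv/= => tL.
  have i1 : 0 < (Y + (- (b / v) - k))^-1 by rewrite invr_gt0.
  have i2 : 0 < (Y + (b / v - k))^-1 by rewrite invr_gt0.
  split=> //.
  have [td|td] := leP d `|t - t0|; first by apply: le_trans (hm _ tL td); exact: ltW.
  case: tO => /=; rewrite in_itv/= => /andP[h1 h2].
  - have tt0 : t < t0 by apply: le_lt_trans h2 _; rewrite ltrBlDr ltrDl.
    have nt : t != t0 by rewrite lt_eqF.
    have := hd _ nt tL td; rewrite yv// [`|t - t0|]ltr0_norm ?subr_lt0//.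
    have s0 : 0 < - (t - t0) by rewrite oppr_gt0 subr_lt0.
    rewrite [(t - t0) / _](_ : _ = - 1); last by field; rewrite -oppr_eq0 gt_eqF.
    have : (- (t - t0))^-1 <= Y + (- (b / v) - k).
      by rewrite -[leLHS]div1r ler_pdivrMr// mulrC -ler_pdivrMr// div1r; clear -h1 h2; lra.
    by rewrite ler_norml; clear -h1 h2; lra.
  - have tt0 : t0 < t by apply: lt_le_trans h1; rewrite ltrDl.
    have nt : t != t0 by rewrite gt_eqF.
    have := hd _ nt tL td; rewrite yv// [`|t - t0|]gtr0_norm ?subr_gt0//.
    have s0 : 0 < t - t0 by rewrite subr_gt0.
    rewrite divff ?gt_eqF//.
    have : (t - t0)^-1 <= Y + (b / v - k).
      by rewrite -[leLHS]div1r ler_pdivrMr// mulrC -ler_pdivrMr// div1r; clear -h1 h2; lra.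
    by rewrite ler_norml; clear -h1 h2; lra.
have out2 : S `<=` outside L t0 (Y + (- (b / v) + k)) (Y + (b / v + k)).
  move=> t [tL tN]; have nt : t != t0.
    by apply/eqP => tt0; move: tN; rewrite tt0 N0 leNgt eps0.
  have r1 : (Y + (- (b / v) + k))^-1 < d by rewrite invf_plt ?posrE//; clear -YB bn bn' k0 k1; lra.
  have r2 : (Y + (b / v + k))^-1 < d by rewrite invf_plt ?posrE//; clear -YB bn bn' k0 k1; lra.
  move: nt; rewrite neq_lt => /orP[tt0|tt0]; [left|right]; rewrite /= in_itv/=.
  - have nt : t != t0 by rewrite lt_eqF.
    have s0 : 0 < - (t - t0) by rewrite oppr_gt0 subr_lt0.
    have [td|td] := leP d `|t - t0|.
      by move: td; rewrite ltr0_norm ?subr_lt0//; clear -r1 tL tt0; lra.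
    have := hd _ nt tL td; move: tN; rewrite yv// [`|t - t0|]ltr0_norm ?subr_lt0//.
    rewrite [(t - t0) / _](_ : _ = - 1); last by field; rewrite -oppr_eq0 gt_eqF.
    rewrite ler_norml => h1 h2.
    have : (- (t - t0))^-1 <= Y + (- (b / v) + k) by clear -h1 h2; lra.
    rewrite -[leLHS]div1r ler_pdivrMr// mulrC -ler_pdivrMr// div1r.
    by clear -tL tt0; lra.
  - have nt : t != t0 by rewrite gt_eqF.
    have s0 : 0 < t - t0 by rewrite subr_gt0.
    have [td|td] := leP d `|t - t0|.
      by move: td; rewrite gtr0_norm ?subr_gt0//; clear -r2 tL tt0; lra.
    have := hd _ nt tL td; move: tN; rewrite yv// [`|t - t0|]gtr0_norm ?subr_gt0//.
    rewrite divff ?gt_eqF// ler_norml => h1 h2.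
    have : (t - t0)^-1 <= Y + (b / v + k) by clear -h1 h2; lra.
    rewrite -[leLHS]div1r ler_pdivrMr// mulrC -ler_pdivrMr// div1r.
    by clear -tL tt0; lra.
have lb : outside_integral L t0 f (Y + (- (b / v) - k)) (Y + (b / v - k)) <= Rintegral mu S f.
  apply: le_Rintegral_set => //.
  by apply: (integrableS (mO _ _) mS out2); exact: iO.
have ub : Rintegral mu S f <= outside_integral L t0 f (Y + (- (b / v) + k)) (Y + (b / v + k)).
  by apply: le_Rintegral_set => //; exact: iO.
have kv : (k + k) / v <= e / 2.
  by rewrite ler_pdivrMr//; clear -ke; lra.
have [_ _ B1] := hY1 _ Y1Y; have [_ _ B2] := hY2 _ Y2Y.
(* The opposite shifts [b / v] cancel here, and only the margins remain. *)
move: B1 B2; rewrite (_ : _ + _ + (b / v + k) = k + k); last by ring.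
rewrite (_ : - (b / v) - k + _ = - (k + k)); last by ring.
rewrite mulNr !ler_norml => /andP[B1 B1'] /andP[B2 B2'].
by clear -lb ub kv B1 B1' B2 B2'; apply/andP; split; lra.
Qed.

End asymptotics.

(** * Integrals off null sets and rescaled limits *)

Section nonmeasurable.
Local Open Scope ereal_scope.
Context d (T : measurableType d) (R : realType) (mu : {measure set T -> \bar R}).
Import HBNNSimple.

(** The integral is a supremum over simple functions below the integrand, measurable or not. A
    simple function below [f], set to zero on [N], keeps its integral and lies below [g]. *)
Lemma ge0_le_integral_off_null (N : set T) (f g : T -> \bar R) :
  measurable N -> mu N = 0 -> (forall x, 0 <= f x) -> (forall x, 0 <= g x) ->
  (forall x, ~ N x -> f x <= g x) -> \int[mu]_x f x <= \int[mu]_x g x.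
Proof.
move=> mN N0 f0 g0 fg; rewrite !ge0_integralTE//.
apply: ge_ereal_sup => _ [h /= hf <-].
have mC := measurableC mN.
pose h' := proj_nnsfun h mC.
have h'E x : h' x = (h x * \1_(~` N) x)%R by [].
apply: (@le_trans _ _ (sintegral mu h')); last first.
  apply: ereal_sup_ubound; exists h' => // x /=.
  rewrite [X in X%:E](_ : _ = (h x * \1_(~` N) x)%R) ?indicE//.
  have [Nx|Nx] := pselect (N x).
    by rewrite memNset ?mulr0//; exact.
  by rewrite mem_set// mulr1; apply: le_trans (hf x) (fg _ Nx).
rewrite -!integralT_nnsfun le_eqVlt; apply/orP; left; apply/eqP.
apply: ge0_ae_eq_integral; first exact: measurableT.
- exact/measurable_EFinP/measurable_funP.
- exact/measurable_EFinP/measurable_funP.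
- by move=> x _; rewrite lee_fin.
- by move=> x _; rewrite lee_fin.
exists N; split=> // x /=; apply: contra_notP => Nx _.
by congr EFin; rewrite [RHS](_ : _ = (h x * \1_(~` N) x)%R) // indicE mem_set ?mulr1.
Qed.

Lemma integral_off_null (D N : set T) (f g : T -> \bar R) :
  measurable N -> mu N = 0 -> (forall x, D x -> ~ N x -> f x = g x) ->
  \int[mu]_(x in D) f x = \int[mu]_(x in D) g x.
Proof.
move=> mN N0 fg; rewrite integralE [RHS]integralE.
have fgD x : ~ N x -> (f \_ D) x = (g \_ D) x.
  by move=> Nx; rewrite /patch; case: ifPn => //; rewrite inE => Dx; exact: fg.
have eqp : \int[mu]_(x in D) f^\+ x = \int[mu]_(x in D) g^\+ x.
  rewrite integral_mkcond [RHS]integral_mkcond -!funepos_restrict.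
  by apply/eqP; rewrite eq_le; apply/andP; split;
    apply: (ge0_le_integral_off_null mN N0) => // x Nx; rewrite !funeposE fgD.
have eqn : \int[mu]_(x in D) f^\- x = \int[mu]_(x in D) g^\- x.
  rewrite integral_mkcond [RHS]integral_mkcond -!funeneg_restrict.
  by apply/eqP; rewrite eq_le; apply/andP; split;
    apply: (ge0_le_integral_off_null mN N0) => // x Nx; rewrite !funenegE fgD.
by rewrite eqp eqn.
Qed.

End nonmeasurable.

(** * Limits at [0+] under rescaling *)

Section at_right_limits.
Context {R : realType}.

Lemma cvg_at_right0P (F : R -> R) (l : R) : F @ 0^'+ --> l <->
  forall e : R, 0 < e -> exists2 d : R, 0 < d & forall x : R, 0 < x < d -> `|F x - l| <= e.
Proof.
split=> [/cvgrPdist_le Fl e e0|h].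
  have := Fl _ e0; rewrite near_withinE => /nbhs_ballP[d /= d0 hd].
  exists d => // x /andP[x0 xd]; rewrite distrC; apply: hd => //.
  by rewrite /ball/= sub0r normrN gtr0_norm.
apply/cvgrPdist_le => e e0; have [d d0 hd] := h _ e0.
rewrite near_withinE; apply/nbhs_ballP; exists d => //= x.
rewrite /ball/= sub0r normrN => xd x0; rewrite distrC; apply: hd.
by rewrite x0 -(gtr0_norm x0).
Qed.

Lemma cvg_rescale (F G : R -> R) (k l : R) : 0 < k ->
  (forall e : R, 0 < e -> exists2 d : R, 0 < d & forall x : R, 0 < x < d ->
    `|G x - k^-1 * F (x / k)| <= e) ->
  F @ 0^'+ --> l -> G @ 0^'+ --> k^-1 * l.
Proof.
move=> k0 FG /cvg_at_right0P Fl; apply/cvg_at_right0P => e e0.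
have e20 : 0 < e / 2 by rewrite divr_gt0.
have [d1 d10 h1] := FG _ e20.
have ek : 0 < k * (e / 2) by rewrite mulr_gt0.
have [d2 d20 h2] := Fl _ ek.
exists (Num.min d1 (d2 * k)); first by rewrite lt_min d10 mulr_gt0.
move=> x /andP[x0]; rewrite lt_min => /andP[xd1 xd2].
have := h1 x; rewrite x0 xd1 => /(_ isT) {}h1.
have := h2 (x / k); rewrite divr_gt0// ltr_pdivrMr// xd2 => /(_ isT) {}h2.
rewrite (_ : _ - _ = (G x - k^-1 * F (x / k)) + k^-1 * (F (x / k) - l)); last by ring.
apply: le_trans (ler_normD _ _) _.
rewrite normrM [`|k^-1|]gtr0_norm ?invr_gt0//.
have h3 : k^-1 * `|F (x / k) - l| <= e / 2 by rewrite ler_pdivrMl.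
by lra.
Qed.

(* If one of the two limits does not exist then neither does the other one, and
   both [lim]s take the default value [0]. *)
Lemma lim_rescale (F G : R -> R) (k : R) : 0 < k ->
  (forall e : R, 0 < e -> exists2 d : R, 0 < d & forall x : R, 0 < x < d ->
    `|G x - k^-1 * F (x / k)| <= e) ->
  lim (G @ 0^'+) = k^-1 * lim (F @ 0^'+).
Proof.
move=> k0 FG.
have [/cvg_ex[l Fl]|nF] := pselect (cvg (F @ 0^'+)).
  have -> : lim (F @ 0^'+) = l by exact: cvg_lim Fl.
  by apply: cvg_lim => //; exact: cvg_rescale Fl.
have nG : ~ cvg (G @ 0^'+).
  move=> /cvg_ex[l Gl]; apply: nF; apply/cvg_ex; exists (k * l).
  have ik0 : 0 < k^-1 by rewrite invr_gt0.
  (* The hypothesis is symmetric under exchanging [F] with [G] and [k] with [k^-1]. *)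
  have := @cvg_rescale G F k^-1 l ik0; rewrite invrK; apply=> // e e0.
  have ek : 0 < k^-1 * e by rewrite mulr_gt0.
  have [d d0 hd] := FG _ ek.
  exists (d / k); first by rewrite divr_gt0.
  move=> x /andP[x0]; rewrite ltr_pdivlMr// => xd.
  have := hd (x * k); rewrite mulr_gt0// xd mulfK ?gt_eqF// => /(_ isT).
  rewrite (_ : F x - _ = - (k * (G (x * k) - k^-1 * F x))); last first.
    by field; rewrite gt_eqF.
  rewrite normrN normrM gtr0_norm// => h.
  by rewrite -ler_pdivlMl.
have p0 : point = 0 :> R by [].
by rewrite (dvgP nG) (dvgP nF) p0 mulr0.
Qed.

End at_right_limits.

(** * The potential of a Legendrian knot *)

Section curve_continuity.
Context {R : realType}.
Implicit Types (g : R -> S3 R) (p q : hpt R) (F : R -> R).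

Lemma near_eq_continuous F (G : R -> R) (t : R) : (\forall s \near t, F s = G s) ->
  {for t, continuous F} -> {for t, continuous G}.
Proof.
move=> FG; rewrite /prop_for /continuous_at -(nbhs_singleton FG).
by apply: cvg_trans; apply: near_eq_cvg; apply: filterS FG => s ->.
Qed.

Definition cnorm (k : R) g (t : R) : R :=
  match g t with Some q => knorm q | None => k end.

Lemma continuous_sqrt_isd F (t df : R) : is_derive t 1 F df ->
  {for t, continuous (fun s => Num.sqrt (F s))}.
Proof.
move=> /isd_continuous cF.
by apply: (@continuous_comp _ _ _ F Num.sqrt) => //; exact: sqrt_continuous.
Qed.

Lemma legendrian_near_continuous g (t k : R) : legendrian_near g t ->
  {for t, continuous (speed g)} /\ {for t, continuous (cnorm k g)}.
Proof.
move=> /legendrian_nearP[e [X [Y [U [e0 [hX hY hU h] gE]]]]].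
have te : `|t - t| < e by rewrite subrr normr0.
split.
  apply: (@near_eq_continuous
      (fun s => Num.sqrt (derive1 X s ^+ 2 + derive1 Y s ^+ 2))).
    apply: filterS (near_dist_lt te) => s se; apply/esym/speedE.
    by apply: filterS (near_dist_lt se) => r; exact: gE.
  have dX := smooth_on_isd (smooth_on_derive1 hX) te.
  have dY := smooth_on_isd (smooth_on_derive1 hY) te.
  exact: continuous_sqrt_isd (isdD (isdX2 dX) (isdX2 dY)).
apply: (@near_eq_continuous (fun s => Num.sqrt (Num.sqrt
    ((X s ^+ 2 + Y s ^+ 2) ^+ 2 + (4 * U s) ^+ 2)))).
  apply: filterS (near_dist_lt te) => s se.
  by rewrite /cnorm gE// knormE gauge4E.
have dX := smooth_on_isd hX te; have dY := smooth_on_isd hY te.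
have dU := smooth_on_isd hU te.
have c1 := continuous_sqrt_isd (isdD (isdX2 (isdD (isdX2 dX) (isdX2 dY)))
  (isdX2 (isdM (is_derive_cst (4 : R) t 1) dU))).
exact: (@continuous_comp _ _ _ _ Num.sqrt _ c1 (@sqrt_continuous R _)).
Qed.

Lemma segment_bounded F (a b : R) :
  (forall t, a <= t <= b -> {for t, continuous F}) ->
  exists M : R, forall t, a <= t <= b -> F t <= M.
Proof.
move=> cF; have [ab|ba] := leP a b; last first.
  by exists 0 => t /andP[h1 h2]; have := le_lt_trans (le_trans h1 h2) ba; rewrite ltxx.
have cF' : {within `[a, b], continuous F}.
  apply: continuous_in_subspaceT => /= t; rewrite inE/= in_itv/=; exact: cF.
have [c _ hc] := EVT_max ab cF'.
by exists (F c) => t tab; apply: hc; rewrite in_itv.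
Qed.

Lemma measurable_fun_off_points F (L t1 t2 : R) :
  (forall t, 0 < t < L -> t != t1 -> t != t2 -> {for t, continuous F}) ->
  measurable_fun (`[0, L[%classic : set (measurableTypeR R)) F.
Proof.
move=> cF.
pose V : set R := `]0, L[%classic `&` (~` [set t1] `&` ~` [set t2]).
have oV : open V.
  apply: openI; first exact: interval_open.
  by apply: openI; apply: closed_openC; apply: accessible_closed_set1; exact: hausdorff_accessible.
have mF : measurable_fun (V : set (measurableTypeR R)) F.
  apply: open_continuous_measurable_fun => // t; rewrite inE /V/= in_itv/=.
  by move=> [tL [/eqP n1 /eqP n2]]; exact: cF.
have mV : measurable (V : set (measurableTypeR R)) by exact: open_measurable.
pose W : set (measurableTypeR R) := V `|` ([set 0] `|` ([set t1] `|` [set t2])).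
have m1 (x : R) : measurable ([set x] : set (measurableTypeR R)) by exact: measurable_set1.
have mW : measurable W by do 3!apply: measurableU => //.
apply: (@measurable_funS _ _ _ _ W) => //.
  move=> t /=; rewrite in_itv/= => /andP[h1 h2].
  have [->|n0] := eqVneq t 0; first by right; left.
  have [->|n1] := eqVneq t t1; first by right; right; left.
  have [->|n2] := eqVneq t t2; first by right; right; right.
  by left; split; [rewrite /= in_itv/= h2 lt_def n0 h1|split; exact/eqP].
have mp (x : R) : measurable_fun ([set x] : set (measurableTypeR R)) F.
  exact: measurable_fun_set1.
apply/measurable_funU => //; first by do 2!apply: measurableU => //.
split=> //; apply/measurable_funU => //; first by apply: measurableU => //.
by split=> //; apply/measurable_funU.
Qed.

End curve_continuity.

(** * Density and distance seen from a point of the knot *)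

Section knot.
Context {R : realType}.
Implicit Types (g : R -> S3 R) (p q : hpt R).

Definition density g p (t : R) : R :=
  match g t with Some q => (kdist p q ^+ 2)^-1 * speed g t | None => 0 end.

(** The value 1 at infinity keeps the distance positive and bounded below away from [p]; the density
    is 0 there, so the integrals do not see this choice. *)
Definition distance g p (t : R) : R :=
  match g t with Some q => kdist p q | None => 1 end.

Lemma speed_ge0 g (t : R) : 0 <= speed g t.
Proof. exact: sqrtr_ge0. Qed.

Lemma density_ge0 g p (t : R) : 0 <= density g p t.
Proof.
rewrite /density; case: (g t) => // q.
by rewrite mulr_ge0 ?invr_ge0 ?sqr_ge0// speed_ge0.
Qed.

Lemma hmul_hinv p : hmul (hinv p) p = HPt 0 0 0.
Proof. by case: p => x y u; rewrite /hmul/=; congr HPt; ring. Qed.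

Lemma hmul_hinv_inj p q : hmul (hinv p) q = HPt 0 0 0 -> q = p.
Proof.
case: p => x y u; case: q => x' y' u'; rewrite /hmul/= => -[h1 h2 h3].
have ex : x' = x by rewrite -[x']add0r -(subrr x) -addrA h1 addr0.
have ey : y' = y by rewrite -[y']add0r -(subrr y) -addrA h2 addr0.
rewrite ex ey in h3 *; congr HPt; lra.
Qed.

Lemma distanceE g p : distance g p = cnorm 1 (ltranslation (hinv p) \o g).
Proof. by apply/funext => t; rewrite /distance /cnorm/=; case: (g t). Qed.

Lemma knot_ltranslation L g p : legendrian_knot L g ->
  legendrian_knot L (ltranslation (hinv p) \o g).
Proof. by move=> gK; apply: knot_generator gK _; exact: gen_tr. Qed.

Lemma speed_ltranslation L g p q (t : R) : legendrian_knot L g -> g t = Some q ->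
  speed (ltranslation (hinv p) \o g) t = speed g t.
Proof.
move=> gK gt; have [_ h] := contact_ltranslation (hinv p) q.
by have [_ ->] := h g t gt (knot_near_finite gK gt); rewrite expr1n mul1r.
Qed.

Lemma knot_at_infinity L g : legendrian_knot L g ->
  exists t2, forall t, 0 <= t < L -> g t = None -> t = t2.
Proof.
move=> [_ [_ [gI _]]].
have [[t2 [h2 e2]]|n] := pselect (exists t2, 0 <= t2 < L /\ g t2 = None).
  by exists t2 => t tL gt; apply: gI => //; rewrite gt.
by exists 0 => t tL gt; exfalso; apply: n; exists t.
Qed.

Section at_point.
Variables (L t0 : R) (g : R -> S3 R) (p : hpt R).
Hypotheses (gK : legendrian_knot L g) (t00 : 0 < t0) (t0L : t0 < L).
Hypothesis gt0 : g t0 = Some p.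

(* The curve with [p] sent to infinity: its length element is [dq / d(p, q) ^ 2]. *)
Let w := @inversion R \o (ltranslation (hinv p) \o g).

Let wK : legendrian_knot L w.
Proof. by apply: knot_generator (knot_ltranslation p gK) _; exact: gen_inv. Qed.

(** The closed period is needed for compactness; at [t = L] periodicity would give [g 0 = Some p],
    against [0 < t0]. *)
Let inj_t0 t : 0 <= t <= L -> g t = Some p -> t = t0.
Proof.
have [_ [gP [gI _]]] := gK; have p0 := t00; have pL := t0L.
move=> /andP[h1]; rewrite le_eqVlt => /orP[/eqP ->|h2] gt; last first.
  by apply: gI; rewrite ?h1 ?h2 ?t0L ?ltW// gt gt0.
have g0 : g 0 = Some p by rewrite -gt -[RHS](congr1 g (add0r L)) gP.
have e : 0 = t0.
  by apply: gI; rewrite ?lexx ?t0L ?(ltW t00)// ?(lt_trans t00 t0L)// g0 gt0.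
by move: p0; rewrite -e ltxx.
Qed.

Let gauge_neq0 t q : 0 <= t <= L -> t != t0 -> g t = Some q ->
  gauge4 (hmul (hinv p) q) != 0.
Proof.
move=> tL nt gt; apply: contra_neq nt => /gauge4_eq0/hmul_hinv_inj qp.
by apply: inj_t0 => //; rewrite gt qp.
Qed.

Let w_finite t : 0 <= t <= L -> t != t0 -> exists q, w t = Some q.
Proof.
move=> tL nt; rewrite /w/=; case gt : (g t) => [q|]; last by eexists.
exists (inv_pt (hmul (hinv p) q)).
by rewrite -[LHS]/(inversion (Some (hmul (hinv p) q))) inversion_pt//; exact: gauge_neq0 gt.
Qed.

Let w_legendrian t : 0 <= t <= L -> t != t0 -> legendrian_near w t.
Proof. by move=> tL nt; have [q wt] := w_finite tL nt; exact: knot_near_finite wK wt. Qed.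

(** This transfers bounds from [w], which is finite and smooth off [t0] even where [g] is infinite,
    to the density and to the inverse of the distance. *)
Let wE t q : 0 <= t <= L -> t != t0 -> g t = Some q ->
  density g p t = speed w t /\ distance g p t = (cnorm 0 w t)^-1 /\
  0 < distance g p t.
Proof.
move=> tL nt gt; have q0 := gauge_neq0 tL nt gt.
set q' := hmul (hinv p) q in q0.
have kq0 : 0 < knorm q' by rewrite knorm_gt0// lt_def q0 gauge4_ge0.
have ht : (ltranslation (hinv p) \o g) t = Some q' by rewrite /= gt.
have [_ hI] := contact_inversion q0.
have [_ sw] := hI _ t ht (knot_near_finite (knot_ltranslation p gK) ht).
rewrite /density /distance gt kdistE -/q' sw (speed_ltranslation p gK gt) exprVn.
split=> //; split=> //; rewrite /cnorm /w.
rewrite (_ : (_ \o _) t = inversion (Some q')); last by rewrite /= gt.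
rewrite inversion_pt//.
have : knorm (inv_pt q') * knorm q' = 1.
  rewrite (@knormM _ _ _ (HPt 1 0 0)).
    by rewrite knormE gauge4E/= !(mulr0, expr0n, addr0, expr1n) !sqrtr1.
  by rewrite gauge4_inv// mulVf// gauge4E/= !(mulr0, expr0n, addr0, expr1n).
by move=> /(canRL (mulfK (lt0r_neq0 kq0))) ->; rewrite mul1r invrK.
Qed.

Let w_bounded (F : R -> R) (eta : R) : 0 < eta ->
  (forall t, 0 <= t <= L -> t != t0 -> {for t, continuous F}) ->
  exists2 M : R, 0 < M & forall t, 0 <= t < L -> eta <= `|t - t0| -> F t <= M.
Proof.
move=> eta0 cF.
have [M1 h1] : exists M : R, forall t, 0 <= t <= t0 - eta -> F t <= M.
  apply: segment_bounded => t /andP[a1 a2].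
  have lt0 : t < t0 by apply: le_lt_trans a2 _; rewrite ltrBlDr ltrDl.
  by apply: cF; rewrite ?lt_eqF// a1/= (ltW (lt_trans lt0 t0L)).
have [M2 h2] : exists M : R, forall t, t0 + eta <= t <= L -> F t <= M.
  apply: segment_bounded => t /andP[a1 a2].
  have lt0 : t0 < t by apply: lt_le_trans a1; rewrite ltrDl.
  by apply: cF; rewrite ?gt_eqF// a2 andbT (ltW (lt_trans t00 lt0)).
exists (Num.max 1 (Num.max M1 M2)); first by rewrite lt_max ltr01.
move=> t /andP[t_ge0 tL] te; rewrite !le_max.
have [tt0|tt0] := leP t t0.
  rewrite h1 ?orbT// t_ge0/=; move: te; rewrite ler0_norm ?subr_le0// opprB.
  by rewrite lerBrDr addrC -lerBrDr.
rewrite h2 ?orbT// (ltW tL) andbT; move: te; rewrite gtr0_norm ?subr_gt0//.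
by rewrite lerBrDr addrC.
Qed.

Lemma distance_gt0 t : t != t0 -> 0 <= t < L -> 0 < distance g p t.
Proof.
move=> nt /andP[h1 /ltW h2].
case gt : (g t) => [q|]; last by rewrite /distance gt ltr01.
have tL : 0 <= t <= L by rewrite h1.
by have [_ [_]] := wE tL nt gt.
Qed.

Lemma distance_t0 : distance g p t0 = 0.
Proof.
rewrite /distance gt0 kdistE hmul_hinv knormE gauge4_0.
by rewrite !sqrtr0.
Qed.

Lemma density_bounded (eta : R) : 0 < eta -> exists M : R, forall t : R,
  0 <= t < L -> eta <= `|t - t0| -> density g p t <= M.
Proof.
move=> eta0; have [|M M0 hM] := @w_bounded (speed w) _ eta0.
  by move=> t tL nt; exact: (legendrian_near_continuous 0 (w_legendrian tL nt)).1.
exists M => t tL te; have := tL => /andP[h1 /ltW h2].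
have nt : t != t0.
  by apply: contraTneq te => ->; rewrite subrr normr0 -ltNge.
case gt : (g t) => [q|]; last by rewrite /density gt ltW.
have tL' : 0 <= t <= L by rewrite h1.
have [-> _] := wE tL' nt gt.
exact: hM.
Qed.

Lemma distance_bounded (eta : R) : 0 < eta -> exists2 m : R, 0 < m & forall t : R,
  0 <= t < L -> eta <= `|t - t0| -> m <= distance g p t.
Proof.
move=> eta0; have [|M M0 hM] := @w_bounded (cnorm 0 w) _ eta0.
  by move=> t tL nt; exact: (legendrian_near_continuous 0 (w_legendrian tL nt)).2.
exists (Num.min 1 M^-1); first by rewrite lt_min ltr01 invr_gt0.
move=> t tL te; have := tL => /andP[h1 /ltW h2].
have nt : t != t0.
  by apply: contraTneq te => ->; rewrite subrr normr0 -ltNge.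
case gt : (g t) => [q|]; last by rewrite /distance gt ge_min lexx.
have tL' : 0 <= t <= L by rewrite h1.
have [_ [dE d0]] := wE tL' nt gt.
rewrite ge_min; apply/orP; right; rewrite dE lef_pV2 ?posrE//; first exact: hM.
by move: d0; rewrite dE invr_gt0.
Qed.

Let h := ltranslation (hinv p) \o g.
Let hK : legendrian_knot L h := knot_ltranslation p gK.

Let distance_continuous t q : g t = Some q -> {for t, continuous (distance g p)}.
Proof.
move=> gt; rewrite distanceE.
have ht : h t = Some (hmul (hinv p) q) by rewrite /h/= gt.
exact: (legendrian_near_continuous 1 (knot_near_finite hK ht)).2.
Qed.

Lemma measurable_distance :
  measurable_fun (`[0, L[%classic : set (measurableTypeR R)) (distance g p).
Proof.
have [t2 ht2] := knot_at_infinity gK.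
apply: (@measurable_fun_off_points _ _ _ t0 t2) => t /andP[h1 h2] n1 n2.
case gt : (g t) => [q|]; first exact: distance_continuous gt.
by move: n2; rewrite (ht2 t _ gt) ?eqxx// (ltW h1).
Qed.

Lemma measurable_density :
  measurable_fun (`[0, L[%classic : set (measurableTypeR R)) (density g p).
Proof.
have [t2 ht2] := knot_at_infinity gK.
apply: (@measurable_fun_off_points _ _ _ t0 t2) => t /andP[h1 h2] n1 n2.
case gt : (g t) => [q|]; last by move: n2; rewrite (ht2 t _ gt) ?eqxx// (ltW h1).
have cs := (legendrian_near_continuous 0 (knot_near_finite gK gt)).1.
have cd := distance_continuous gt.
have d0 : distance g p t != 0 by rewrite gt_eqF// distance_gt0// (ltW h1).
apply: (@near_eq_continuous _
    (fun s => (distance g p s * distance g p s)^-1 * speed g s)).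
  have /legendrian_nearP[e [X [Y [U [e0 _ gE]]]]] := knot_near_finite gK gt.
  have te : `|t - t| < e by rewrite subrr normr0.
  apply: filterS (near_dist_lt te) => s se.
  by rewrite /distance /density gE// expr2.
apply: cvgM; last exact: cs.
by apply: cvgV; [rewrite mulf_neq0|exact: cvgM].
Qed.

Lemma speed_gt0 : 0 < speed g t0.
Proof.
have /legendrian_nearP[e [X [Y [U [e0 [_ _ _ hl] gE]]]]] := knot_near_finite gK gt0.
have te : `|t0 - t0| < e by rewrite subrr normr0.
rewrite (speedE (filterS gE (near_dist_lt te))) sqrtr_gt0 lt_def.
by have [/sum_sqr_neq0 -> _] := hl _ te; rewrite addr_ge0 ?sqr_ge0.
Qed.

Lemma distance_expansion : exists b : R, is_derive t0 1
  (fun t : R => if t == t0 then speed g t0 else distance g p t / `|t - t0|) b.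
Proof.
have ht0 : h t0 = Some (HPt 0 0 0).
  by rewrite -(hmul_hinv p) -[LHS]/(ltranslation (hinv p) (g t0)) gt0.
have /legendrian_nearP[e [X [Y [U [e0 hl hE]]]]] := knot_near_finite hK ht0.
have te : `|t0 - t0| < e by rewrite subrr normr0.
have := hE _ te; rewrite ht0 => -[X0 Y0 U0].
have [b db] := knorm_expansion e0 hl (esym X0) (esym Y0) (esym U0).
exists b; apply: isd_near db; apply: filterS (near_dist_lt te) => t tte.
rewrite -(speed_ltranslation p gK gt0) (speedE (filterS hE (near_dist_lt te))).
case: eqP => // _; rewrite distanceE /cnorm.
by have := hE _ tte; rewrite /h => ->.
Qed.

Lemma density_pole (eps : R) : 0 < eps -> exists2 d : R, 0 < d & forall t : R,
  t != t0 -> `|t - t0| < d -> `|density g p t * (t - t0) ^+ 2 - (speed g t0)^-1| <= eps.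
Proof.
move=> eps0; have [b db] := distance_expansion.
have v0 := speed_gt0.
set H := (fun t : R => if _ then _ else _) in db.
have cH := isd_continuous db.
have H0 : H t0 = speed g t0 by rewrite /H eqxx.
have cs := (legendrian_near_continuous 0 (knot_near_finite gK gt0)).1.
have Hn0 : H t0 != 0 by rewrite H0 gt_eqF.
(* Off [t0] this function is the density times [(t - t0) ^ 2], and its value at [t0] is
   [v / v ^ 2]. *)
have c : {for t0, continuous (fun t => (H t * H t)^-1 * speed g t)}.
  apply: cvgM; last exact: cs.
  by apply: cvgV; [rewrite mulf_neq0|exact: cvgM].
have /legendrian_nearP[e [X [Y [U [e0 _ gE]]]]] := knot_near_finite gK gt0.
have /cvgrPdist_le/(_ _ eps0) := c.
move=> /nbhs_ballP[d /= d0 hd].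
exists (Num.min d e); first by rewrite lt_min d0.
move=> t nt; rewrite lt_min => /andP[td te].
have := hd t; rewrite /ball/= distrC => /(_ td); rewrite distrC H0.
rewrite /H (negbTE nt) /density /distance gE//.
set K := kdist _ _; set s := speed g t; set v := speed g t0 in v0 *.
have nt0 : `|t - t0| != 0 by rewrite normr_eq0 subr_eq0.
rewrite (_ : (v * v)^-1 * v = v^-1); last by field; rewrite gt_eqF.
rewrite -[(t - t0) ^+ 2]ger0_norm ?sqr_ge0// normrX.
have [->|K0] := eqVneq K 0; first by rewrite !(mul0r, expr0n, invr0).
rewrite (_ : (K / `|t - t0| * (K / `|t - t0|))^-1 * s = (K ^+ 2)^-1 * s * `|t - t0| ^+ 2)//.
by field; rewrite K0 nt0.
Qed.

Lemma VpartE (eps : R) : fine (Vpart L g p eps) = Rintegral lebesgue_measure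
  [set t | 0 <= t < L /\ eps <= distance g p t] (density g p).
Proof.
congr fine; rewrite /Vpart [LHS]integral_mkcond [RHS]integral_mkcond.
congr (integral _ _ _); apply/funext => t; rewrite /patch /density.
have [gt|gt] := pselect (g t = None); first by rewrite gt !if_same.
case: ifPn => tS; case: ifPn => tS' //; exfalso; move: tS tS' gt;
  by rewrite ?notin_setE !inE/= /distance; case: (g t).
Qed.

Lemma Vpart_asymptotics (e : R) : 0 < e -> exists2 d : R, 0 < d & forall eps : R,
  0 < eps < d -> `|fine (Vpart L g p eps) -
    outside_integral L t0 (density g p) (speed g t0 / eps) (speed g t0 / eps)| <= e.
Proof.
move=> e0; have [b db] := distance_expansion.
have [d d0 hd] := superlevel_asymptotics t00 t0L speed_gt0 (density_ge0 g p)
  measurable_density density_bounded density_pole measurable_distance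
  distance_bounded distance_t0 distance_gt0 db e0.
by exists d => // eps /hd; rewrite VpartE.
Qed.

End at_point.
End knot.

(** * Invariance of the energy *)

Section invariance.
Context {R : realType}.
Implicit Types (g : R -> S3 R) (p q : hpt R) (G : S3 R -> S3 R).
Local Notation mu := (@lebesgue_measure R).

Lemma null_set1U (a b c : R) :
  measurable ([set a] `|` ([set b] `|` [set c]) : set (measurableTypeR R)) /\
  mu ([set a] `|` ([set b] `|` [set c])) = 0%E.
Proof.
have m1 (x : R) : measurable ([set x] : set (measurableTypeR R)) by exact: measurable_set1.
have m2 : measurable ([set b] `|` [set c] : set (measurableTypeR R)).
  exact: measurableU.
split; first exact: measurableU.
rewrite measureU0//; first exact: lebesgue_measure_set1.
rewrite measureU0//; first exact: lebesgue_measure_set1.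
exact: lebesgue_measure_set1.
Qed.

Section conformal.
Variables (L t0 : R) (g : R -> S3 R) (G : S3 R -> S3 R) (p p' : hpt R).
Variable rho : hpt R -> R.
Hypotheses (gK : legendrian_knot L g) (GK : mobius_generator G).
Hypotheses (t00 : 0 < t0) (t0L : t0 < L).
Hypotheses (gt0 : g t0 = Some p) (Gp : G (Some p) = Some p').
Hypothesis Grho : forall p p', G (Some p) = Some p' -> contact_at G p (rho p) /\
  forall q q', G (Some q) = Some q' -> kdist p' q' = rho p * rho q * kdist p q.

Let hK : legendrian_knot L (G \o g) := knot_generator gK GK.
Let ht0 : (G \o g) t0 = Some p'.
Proof. by rewrite /= gt0. Qed.

Let k : R := rho p ^+ 2.
Let k0 : 0 < k.
Proof. by have [[r0 _] _] := Grho Gp; rewrite exprn_gt0. Qed.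

Lemma conformal_speed : speed (G \o g) t0 = k * speed g t0.
Proof.
have [[_ h] _] := Grho Gp.
by have [_ ->] := h _ _ gt0 (knot_near_finite gK gt0).
Qed.

Lemma conformal_density t q q' : g t = Some q -> (G \o g) t = Some q' ->
  density (G \o g) p' t = k^-1 * density g p t.
Proof.
move=> gt ht; have Gq : G (Some q) = Some q' by rewrite -ht /= gt.
rewrite /density ht gt.
have [[r0 _] /(_ _ _ Gq) ->] := Grho Gp.
have [[rq0 h] _] := Grho Gq.
have [_ ->] := h _ _ gt (knot_near_finite gK gt).
rewrite /k; have [->|d0] := eqVneq (kdist p q) 0.
  by rewrite mulr0 expr0n invr0 !mul0r mulr0.
by field; rewrite d0 !gt_eqF.
Qed.

Lemma conformal_J (y : R) : 0 < y ->
  outside_integral L t0 (density (G \o g) p') y y = k^-1 * outside_integral L t0 (density g p) y y.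
Proof.
move=> y0; have [t1 ht1] := knot_at_infinity gK.
have [t2 ht2] := knot_at_infinity hK.
have mO : measurable (outside L t0 y y : set (measurableTypeR R)) by exact: measurableU.
rewrite /outside_integral -RintegralZl//; last first.
  apply: (@integrable_outside _ _ _ _ (density_ge0 g p) (measurable_density gK t00 t0L gt0)
    (density_bounded gK t00 t0L gt0) _ (Num.min y^-1 y^-1)).
  - by rewrite lt_min invr_gt0 y0.
  - exact: mO.
  - exact: outside_away.
have [mN N0] := null_set1U t1 t2 t2.
congr fine; apply: (integral_off_null mN N0) => t tO nN; congr EFin.
have /= := outside_sub t00 t0L y0 y0 tO; rewrite in_itv/= => tL.
case gt : (g t) => [q|]; last by exfalso; apply: nN; left; exact: ht1.
case ht : ((G \o g) t) => [q'|]; last by exfalso; apply: nN; right; left; exact: ht2.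
by rewrite (conformal_density gt ht) /density gt.
Qed.

Lemma conformal_Vpot : Vpot L (G \o g) p' = k^-1 * Vpot L g p.
Proof.
rewrite /Vpot; apply: lim_rescale k0 _ => e e0.
have e20 : 0 < e / 2 by rewrite divr_gt0.
have [d1 d10 h1] := Vpart_asymptotics hK t00 t0L ht0 e20.
have ke0 : 0 < k * (e / 2) by rewrite mulr_gt0.
have [d2 d20 h2] := Vpart_asymptotics gK t00 t0L gt0 ke0.
exists (Num.min d1 (d2 * k)); first by rewrite lt_min d10 mulr_gt0.
move=> x /andP[x0]; rewrite lt_min => /andP[xd1 xd2].
have := h1 x; rewrite x0 xd1 => /(_ isT).
have := h2 (x / k); rewrite divr_gt0// ltr_pdivrMr// xd2 => /(_ isT).
have v0 := speed_gt0 gK gt0.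
rewrite conformal_speed conformal_J; last by rewrite divr_gt0// mulr_gt0.
(* The speed is multiplied by [k], so radius [x] for the image and radius [x / k] for the knot
   remove the same parameter interval. *)
have -> : k * speed g t0 / x = speed g t0 / (x / k).
  by field; rewrite !gt_eqF.
set a := fine (Vpart L g p (x / k)); set b := fine _.
set c := outside_integral _ _ _ _ _ => ac bc.
(* The counterterms cancel exactly, since [2 / x = k^-1 * (2 / (x / k))]. *)
rewrite (_ : _ - _ = (b - k^-1 * c) - k^-1 * (a - c)); last first.
  by field; rewrite !gt_eqF.
apply: le_trans (ler_normB _ _) _; rewrite normrM [`|k^-1|]gtr0_norm ?invr_gt0//.
have h3 : k^-1 * `|a - c| <= e / 2 by rewrite ler_pdivrMl.
by rewrite [leRHS]splitr lerD.
Qed.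

Lemma conformal_energy_density :
  Vpot L (G \o g) p' * speed (G \o g) t0 = Vpot L g p * speed g t0.
Proof.
by rewrite conformal_Vpot conformal_speed mulrACA mulVf ?mul1r// gt_eqF.
Qed.

End conformal.

Lemma energy_generator L g G : legendrian_knot L g -> mobius_generator G ->
  energy L g = energy L (G \o g).
Proof.
move=> gK GK; have [rho Grho] := generator_conformal GK.
have hK := knot_generator gK GK.
have [t1 ht1] := knot_at_infinity gK; have [t2 ht2] := knot_at_infinity hK.
(* The parameter 0 is discarded because the asymptotics need [t0] inside the period, with room on
   both sides. *)
have [mN N0] := null_set1U 0 t1 t2.
apply: (integral_off_null mN N0) => t /=; rewrite in_itv/= => tL nN.
have t0 : 0 < t.
  by rewrite lt_def (andP tL).1 andbT; apply/eqP => t0; apply: nN; left.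
have tltL := (andP tL).2.
case gt : (g t) => [p|]; last by exfalso; apply: nN; right; left; exact: ht1.
case ht : (G (Some p)) => [p'|]; last first.
  by exfalso; apply: nN; right; right; apply: ht2 => //; rewrite /= gt.
by rewrite (conformal_energy_density gK GK t0 tltL gt ht Grho).
Qed.

End invariance.

Theorem theorem4p1 (R : realType) (L : R) (g : R -> S3 R)
    (T : S3 R -> S3 R) :
  legendrian_knot L g -> mobius T ->
  energy L g = energy L (T \o g).
Proof.
move=> gK hT.
(* The induction carries the knot property along, as the next generator acts on the image knot. *)
suff : legendrian_knot L (T \o g) /\ energy L g = energy L (T \o g) by case.
elim: hT => [//|G {}T GG _ [TK ->]].
split; first exact: (knot_generator TK GG).
exact: (energy_generator TK GG).
Qed.
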